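(* Let $S(r)=\Psi_m(\mathbf{b}_2(o,r))$ be the number of points of the PLP-MCP in the disk of radius $r>0$ centered at the origin. For all $s\in[0,1]$, $$\mathbb{E}[s^{S(r)}]=\mathcal{P}_{S(r)}(s)=\exp\Big(-2\pi\lambda_L\Big(r-\int_0^r\frac{e^{g(s,t)}\,t}{\sqrt{r^2-t^2}}\,dt\Big)\Big).$$
   Context: Lines: for $(\rho,\phi)\in\mathbb{R}\times[0,\pi)$ let $\mathsf{L}(\rho,\phi)=\{(x_1,x_2)\in\mathbb{R}^2: x_1\cos\phi+x_2\sin\phi=\rho\}$, and for $\ell=\mathsf{L}(\rho,\phi)$ let $f_\ell:\mathbb{R}\to\ell$, $f_\ell(x)=(\rho\cos\phi+x\sin\phi,\ \rho\sin\phi-x\cos\phi)$ (arc-length parametrization). Poisson line process (PLP): $\Phi=\{\ell_i=\mathsf{L}(\rho_i,\phi_i)\}$, where $\{(\rho_i,\phi_i)\}$ is a homogeneous Poisson point process (PPP) on $\mathbb{R}\times[0,\pi)$ with intensity $\lambda_L>0$. One-dimensional Matérn cluster process MCP$(m,\lambda_P,a)$ on $\mathbb{R}$ ($m,\lambda_P,a>0$): a parent homogeneous PPP $\Psi$ of intensity $\lambda_P$ on $\mathbb{R}$; given $\Psi$, each parent $x\in\Psi$ independently receives a daughter process $\overline\Delta_x$, a homogeneous PPP of intensity $\lambda_d=m/(2a)$ on $[x-a,x+a]$; the MCP is $\overline\Psi=\bigcup_{x\in\Psi}\overline\Delta_x$ (parents not included). PLP-MCP: given $\Phi$, attach to each $\ell_i$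 an independent copy $\overline\Psi_i$ of MCP$(m,\lambda_P,a)$ and set $\Psi_m=\bigcup_i f_{\ell_i}(\overline\Psi_i)$. It is a stationary point process in $\mathbb{R}^2$ with intensity $\lambda_m=\pi\lambda_L\lambda_P m$. Let $\beta(t)=2\min(t,a)$ and, for $s\ne1$, $t\ge0$, $g(s,t)=2\lambda_P\big[|t-a|e^{\lambda_d\beta(t)(s-1)}-(t+a)+\frac{e^{\lambda_d\beta(t)(s-1)}-1}{\lambda_d(s-1)}\big]$, extended to $s=1$ by continuity ($g(1,t)=0$). *)

(* Defs.v *)
From mathcomp Require Import all_boot all_order all_algebra.
From mathcomp Require Import all_classical all_reals all_analysis.
Set Implicit Arguments. Unset Strict Implicit. Unset Printing Implicit Defensive.
Import Order.TTheory GRing.Theory Num.Theory.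
Local Open Scope ring_scope.
Local Open Scope classical_set_scope.

(* Point processes are represented as random, labelled, countable point      *)
(* families: point number i is present at outcome w iff [pres i w], and then *)
(* sits at [pos i w].  Multiplicities are counted.                           *)

Section PointProcesses.
Context {R : realType} {d : measure_display} {T : measurableType d}.
Context {dX : measure_display} {X : measurableType dX}.

Definition pp_count (pres : nat -> T -> bool) (pos : nat -> T -> X)
    (w : T) (B : set X) : \bar R :=
  (\sum_(i <oo) ((pres i w && `[< B (pos i w) >])%:R)%:E)%E.

Definition poisson_mass (mu : R) (k : nat) : R :=
  mu ^+ k / k`!%:R * expR (- mu).

Definition pp_events (pres : nat -> T -> bool) (pos : nat -> T -> X)
    : set (set T) :=
  [set A | exists i, A = [set w | pres i w]] `|`
  [set A | exists i B, measurable B /\ A = pos i @^-1` B].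

Definition pp_is_PPP (P : probability T R) (pres : nat -> T -> bool)
    (pos : nat -> T -> X) (Lam : set X -> \bar R) : Prop :=
  (forall i, measurable [set w | pres i w]) /\
  (forall i, measurable_fun setT (pos i)) /\
  (forall (n : nat) (B : 'I_n -> set X) (k : 'I_n -> nat),
     (forall l, measurable (B l)) ->
     (forall l, (Lam (B l) < +oo)%E) ->
     (forall l l', l != l' -> B l `&` B l' = set0) ->
     P (\bigcap_(l in setT) [set w | pp_count pres pos w (B l) = (k l)%:R%:E])
     = (\prod_(l < n) (poisson_mass (fine (Lam (B l))) (k l))%:E)%E).

End PointProcesses.

Definition mutually_independent {R : realType} {d : measure_display}
    {T : measurableType d} (P : probability T R) {I : eqType}
    (G : I -> set (set T)) : Prop :=
  forall (J : seq I) (A : I -> set T), uniq J ->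
    (forall j, j \in J -> <<s G j >> (A j)) ->
    P (\bigcap_(j in [set j | j \in J]) A j) = (\prod_(j <- J) P (A j))%E.

Section Geometry.
Context {R : realType}.

(* arc-length parametrisation f_l of the line L(rho, phi) *)
Definition line_param (rp : R * R) (x : R) : R * R :=
  (rp.1 * cos rp.2 + x * sin rp.2, rp.1 * sin rp.2 - x * cos rp.2).

Definition disk (r : R) : set (R * R) :=
  [set p | p.1 ^+ 2 + p.2 ^+ 2 <= r ^+ 2].

Definition beta_fn (a t : R) : R := 2 * Num.min t a.

(* g(s,t) with lambda_d = m/(2a), extended by continuity (g(1,t) = 0) *)
Definition g_fn (m lamP a : R) (s t : R) : R :=
  let lamd := m / (2 * a) in
  if s == 1 then 0 else
  2 * lamP * (`|t - a| * expR (lamd * beta_fn a t * (s - 1)) - (t + a)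
              + (expR (lamd * beta_fn a t * (s - 1)) - 1) / (lamd * (s - 1))).

(* s ^ x for a count x in [0, +oo], with s ^ (+oo) := lim s ^ n *)
Definition pgf_pow (s : R) (x : \bar R) : R :=
  match x with
  | EFin y => s `^ y
  | +oo%E => if s == 1 then 1 else 0
  | -oo%E => 0
  end.

End Geometry.

(* Main.v *)
(** Conditionally on the lines, a disk of radius r meets a line at distance rho
    from the origin in a chord of half-length t = sqrt(r^2 - rho^2), so the disk
    count is a sum over the lines of independent Matern cluster counts on [-t, t].
    Writing s^S as an infinite product over labels, the expectation is computed by
    applying three times the Poisson functional
      E prod_i f(x_i) = exp(- int (1 - f) dLambda):
    to the daughters of one parent (f = s on an interval), to the parents of one
    line (this yields exp(g(s, t))), and to the distances rho of the lines, a
    Poisson process of intensity pi * lamL.  The stages are separated by the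
    independence of the sigma-algebras of lines, parents and daughters, used via
    Fubini on the product of two copies of the sample space.  The change of variable
    t = sqrt(r^2 - rho^2) turns the last integral into the stated one. *)

From HB Require Import structures.
Require Import Defs.
From mathcomp Require Import all_boot all_order all_algebra.
From mathcomp Require Import all_classical all_reals all_analysis.
From mathcomp Require Import measurable_realfun ring lra.
Set Implicit Arguments. Unset Strict Implicit. Unset Printing Implicit Defensive.
Import Order.TTheory GRing.Theory Num.Theory.
Import numFieldNormedType.Exports.
Local Open Scope ring_scope.
Local Open Scope classical_set_scope.

(** * Independence and decoupling *)

(** For a single process the Poisson hypothesis gives, besides measurability, only the joint law of
    the counts of finitely many disjoint sets of finite intensity. The Poisson functional is
    therefore computed for step functions and carried to other functions by squeezing, and it is
    applied only to functions equal to 1 off a bounded interval.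

    Clusters belong to labels, not to points: the parents and daughters of label [i] are defined
    whether or not line [i] is present, and an absent label contributes the factor 1. Conditioning
    on the lines thus becomes freezing one of two sample points, after which factors of different
    labels are independent and their means multiply. All factors lie in [0, 1], so infinite products
    converge and expectations pass to the limit by domination, even if the count is infinite at some
    outcomes.

    The angle of a line drops out by Pythagoras and leaves only the length pi of its range; the 2 in
    the exponent comes from the two signs of rho. *)

Section Independence.
Context {R : realType} {d : measure_display} {T : measurableType d}.
Variable P : probability T R.

Definition indep_families (G H : set (set T)) : Prop :=
  forall A B, <<s G >> A -> <<s H >> B -> P (A `&` B) = (P A * P B)%E.

Lemma g_sigma_measurable (G : set (set T)) :
  (forall A, G A -> measurable A) -> forall A, <<s G >> A -> measurable A.
Proof.
move=> mG; apply: smallest_sub => //; exact: sigma_algebra_measurable.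
Qed.

Variables (I : eqType) (G : I -> set (set T)).
Hypothesis mG : forall i A, G i A -> measurable A.
Hypothesis indG : mutually_independent P G.

(** A pi-system containing every [G k] with [k] in [K]. Mutual independence speaks only of finite
    lists of distinct indices with one event each, so it can be applied to these sets directly. *)
Definition cylinders (K : set I) : set (set T) :=
  [set E | exists J A, [/\ uniq J, (forall j, j \in J -> K j),
    (forall j, <<s G j >> (A j)) &
    E = \bigcap_(j in [set j | j \in J]) A j]].

Lemma cylinders_measurable K E : cylinders K E -> measurable E.
Proof.
move=> [J [A [uJ JK GA ->]]]; apply: fin_bigcap_measurable.
  exact: finite_seq.
by move=> j _; apply: (@g_sigma_measurable (G j)) (GA j) => // B /mG.
Qed.

Lemma cylinders_setI K : setI_closed (cylinders K).
Proof.
move=> E F [J1 [A1 [u1 K1 G1 ->]]] [J2 [A2 [u2 K2 G2 ->]]].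
have sT j : <<s G j >> setT.
  by have := @sigma_algebraC _ (G j) _ (@sigma_algebra0 _ setT (G j));
     rewrite setC0.
(* The two lists may share indices: each index is kept once, and a list that misses it contributes
   the whole space. *)
exists (undup (J1 ++ J2)), (fun j => (if j \in J1 then A1 j else setT) `&`
                                      (if j \in J2 then A2 j else setT)).
split.
- exact: undup_uniq.
- by move=> j; rewrite mem_undup mem_cat => /orP[/K1|/K2].
- move=> j; apply: (@measurableI _ (g_sigma_algebraType (G j))).
    by case: ifP => _; [exact: G1|exact: sT].
  by case: ifP => _; [exact: G2|exact: sT].
- apply/seteqP; split => w /=.
    by move=> [h1 h2] j _ /=; split; case: ifP => // jJ; [apply: h1|apply: h2].
  move=> h; split => j /= jJ.
    by have /= [] := h j; rewrite /= ?mem_undup ?mem_cat jJ.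
  by have /= [] := h j; rewrite /= ?mem_undup ?mem_cat jJ ?orbT.
Qed.

Lemma cylindersT K : cylinders K setT.
Proof.
exists [::], (fun=> set0); split => //.
  by move=> j; exact: sigma_algebra0.
by apply/seteqP; split.
Qed.

(** As [K1] and [K2] are disjoint, the two index lists concatenate to a duplicate-free list, over
    which mutual independence gives one product that splits in two. *)
Lemma cylinders_indep K1 K2 E F : K1 `&` K2 = set0 ->
  cylinders K1 E -> cylinders K2 F -> P (E `&` F) = (P E * P F)%E.
Proof.
move=> K12 [J1 [A1 [u1 s1 G1 ->]]] [J2 [A2 [u2 s2 G2 ->]]].
have dJ j : j \in J1 -> j \in J2 -> False.
  by move=> /s1 k1 /s2 k2; have : (K1 `&` K2) j by []; rewrite K12.
pose A j := if j \in J1 then A1 j else A2 j.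
have -> : \bigcap_(j in [set j | j \in J1]) A1 j `&`
    \bigcap_(j in [set j | j \in J2]) A2 j =
    \bigcap_(j in [set j | j \in J1 ++ J2]) A j.
  apply/seteqP; split => w /=.
    move=> [h1 h2] j /=; rewrite mem_cat /A.
    by case: ifP => /= [jJ _|_ jJ]; [apply: h1|apply: h2].
  move=> h; split => j /= jJ; have := h j; rewrite /= mem_cat jJ ?orbT /A.
    by rewrite jJ; apply.
  by case: ifP => [/dJ//|_]; apply.
rewrite indG; last 2 first.
- rewrite cat_uniq u1 u2 andbT /=; apply/hasPn => j jJ2.
  by apply/negP => /dJ; apply.
- by move=> j _; rewrite /A; case: ifP.
rewrite big_cat/= (indG u1)// (indG u2)//; congr (_ * _)%E.
  by apply: eq_big_seq => j jJ; rewrite /A jJ.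
by apply: eq_big_seq => j jJ; rewrite /A; case: ifP => // /dJ /(_ jJ).
Qed.

Lemma bigcup_sub_cylinders K : \bigcup_(k in K) G k `<=` cylinders K.
Proof.
move=> E [k Kk GE]; exists [:: k], (fun j => if j == k then E else set0).
split => //.
- by move=> j; rewrite inE => /eqP ->.
- move=> j; case: eqP => [->|_]; last exact: sigma_algebra0.
  exact: sub_sigma_algebra.
- apply/seteqP; split => w /=.
    by move=> Ew j; rewrite /= inE => /eqP ->; rewrite eqxx.
  by move=> /(_ k); rewrite /= inE eqxx; apply.
Qed.

(** Uniqueness of finite measures on a pi-system: both sides are finite measures in [E], namely [P]
    restricted to [F] and [P] scaled by [P F]. *)
Lemma indep_sigma_unique (C : set (set T)) F : setI_closed C -> C setT ->
  (forall E, C E -> measurable E) -> measurable F ->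
  (forall E, C E -> P (E `&` F) = (P E * P F)%E) ->
  forall E, <<s C >> E -> P (E `&` F) = (P E * P F)%E.
Proof.
move=> CI CT mC mF CF E CE.
have fF : P F \is a fin_num by exact: fin_num_measure.
have F0 : 0 <= fine (P F) by exact: fine_ge0.
have h : forall E, mscale (NngNum F0) P E = (P E * P F)%E.
  by move=> E'; rewrite /mscale/= fineK// muleC.
rewrite -h -[LHS]/(mrestr P mF E).
apply: (@g_sigma_algebra_measure_unique _ _ _ C _ (fun=> setT)) => //.
- by rewrite bigcup_const//; exists 0%N.
- by move=> A CA; exact: etrans (CF A CA) (esym (h A)).
- move=> k; change (P (setT `&` F) < +oo)%E.
  by rewrite setTI ltey_eq fF.
Qed.

(** The uniqueness argument extends one factor at a time, so it runs twice: with [B] fixed it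
    reduces [A] to a cylinder, and with that cylinder fixed it reduces [B] to one. *)
Lemma disjoint_indep_families K1 K2 : K1 `&` K2 = set0 ->
  indep_families (\bigcup_(k in K1) G k) (\bigcup_(k in K2) G k).
Proof.
move=> K12 A B sA sB.
have {}sA : <<s cylinders K1 >> A.
  by apply: sub_sigma_algebra2 sA; exact: bigcup_sub_cylinders.
have {}sB : <<s cylinders K2 >> B.
  by apply: sub_sigma_algebra2 sB; exact: bigcup_sub_cylinders.
have mcyl K E : <<s cylinders K >> E -> measurable E.
  by apply: g_sigma_measurable => ?; exact: cylinders_measurable.
apply: (@indep_sigma_unique (cylinders K1)) => //.
- exact: cylinders_setI.
- exact: cylindersT.
- exact: cylinders_measurable.
- exact: mcyl sB.
move=> E cE; rewrite setIC muleC.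
apply: (@indep_sigma_unique (cylinders K2)) => //.
- exact: cylinders_setI.
- exact: cylindersT.
- exact: cylinders_measurable.
- exact: cylinders_measurable cE.
by move=> F cF; rewrite setIC muleC; exact: (cylinders_indep K12 cE cF).
Qed.

End Independence.

Section Decoupling.
Context {R : realType} {d : measure_display} {T : measurableType d}.
Variables (P : probability T R) (GA GB : set (set T)).
Hypotheses (mA : forall A, GA A -> measurable A)
  (mB : forall A, GB A -> measurable A).
Hypothesis indAB : indep_families P GA GB.
Local Notation TA := (g_sigma_algebraType GA).
Local Notation TB := (g_sigma_algebraType GB).

Lemma measurable_id_g_sigma (H : set (set T)) :
  (forall A, H A -> measurable A) ->
  measurable_fun setT (id : T -> g_sigma_algebraType H).
Proof. by move=> mH _ Y mY; rewrite setTI; exact: g_sigma_measurable mY. Qed.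

Lemma measurable_fun_g_sigma d' (Y : measurableType d') (H : set (set T))
    (f : T -> Y) : (forall A, H A -> measurable A) ->
  measurable_fun setT (f : g_sigma_algebraType H -> Y) ->
  measurable_fun setT f.
Proof.
by move=> mH mf; exact: (measurableT_comp mf (measurable_id_g_sigma mH)).
Qed.

(* The diagonal map pushes P to the product of its restrictions to the two
   sigma-algebras. *)
Lemma decoupling (F : TA * TB -> \bar R) : (forall z, 0 <= F z)%E ->
  measurable_fun setT F ->
  (\int[P]_w F (w, w) = \int[P]_w \int[P]_w' F (w, w'))%E.
Proof.
move=> F0 mF.
have iA := measurable_id_g_sigma mA.
have iB := measurable_id_g_sigma mB.
pose idA : {mfun T >-> TA} := HB.pack (id : T -> TA) (isMeasurableFun.Build _ _ _ _ _ iA).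
pose idB : {mfun T >-> TB} := HB.pack (id : T -> TB) (isMeasurableFun.Build _ _ _ _ _ iB).
have mD : @measurable_fun _ _ T (TA * TB)%type setT (fun w => (w, w)).
  exact: measurable_fun_pair.
pose diag : {mfun T >-> (TA * TB)%type} := HB.pack (fun w : T => ((w : TA), (w : TB)))
   (isMeasurableFun.Build _ _ _ _ _ mD).
pose PA : probability TA R := distribution P idA.
pose PB : probability TB R := distribution P idB.
pose PD : probability (TA * TB)%type R := distribution P diag.
(* The diagonal pulls a rectangle [A * B] back to the intersection of [A] and [B], so agreement on
   rectangles is exactly independence. *)
have PDE X : measurable X -> (PA \x PB)%E X = PD X.
  apply: product_measure_unique => A B sA sB.
  exact: indAB.
transitivity (\int[PD]_z F z)%E.
  by rewrite ge0_integral_distribution.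
transitivity (\int[PA \x PB]_z F z)%E.
  by apply: eq_measure_integral => X mX _; exact: esym (PDE X mX).
rewrite fubini_tonelli1//= ge0_integral_distribution//=; last 2 first.
- exact: measurable_fun_fubini_tonelli_F.
- by move=> w; apply: integral_ge0.
apply: eq_integral => w _.
rewrite [LHS]ge0_integral_distribution//=.
by apply: measurableT_comp mF _; exact: measurable_fun_pair.
Qed.
End Decoupling.

(** * Infinite products and generating functions *)

Section InfiniteProduct.
Context {R : realType}.
Implicit Types (u v : nat -> R).

(** A bare limit, used for factors in [0, 1], where the partial products decrease. The value 0 is
    allowed. *)
Definition iprod u : R := limn (fun n => \prod_(i < n) u i).

Lemma prod_01 u n : (forall i, 0 <= u i <= 1) -> 0 <= \prod_(i < n) u i <= 1.
Proof.
move=> u01; apply/andP; split.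
  by apply: prodr_ge0 => i _; have /andP[] := u01 i.
by apply: prodr_ile1 => i _; exact: u01.
Qed.

Lemma iprod_cvg u : (forall i, 0 <= u i <= 1) ->
  (fun n => \prod_(i < n) u i) @ \oo --> iprod u.
Proof.
move=> u01; apply: nonincreasing_is_cvgn.
  apply/nonincreasing_seqP => n; rewrite big_ord_recr/= ler_piMr//.
    by have /andP[] := prod_01 n u01.
  by have /andP[] := u01 n.
by exists 0 => _ [n _ <-]; have /andP[] := prod_01 n u01.
Qed.

Lemma iprod_01 u : (forall i, 0 <= u i <= 1) -> 0 <= iprod u <= 1.
Proof.
move=> u01; apply/andP; split.
  apply: (limr_ge (cvgP _ (iprod_cvg u01))).
  by apply: nearW => n; have /andP[] := prod_01 n u01.
apply: (limr_le (cvgP _ (iprod_cvg u01))).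
by apply: nearW => n; have /andP[] := prod_01 n u01.
Qed.

Lemma iprod_le u v : (forall i, 0 <= u i) -> (forall i, v i <= 1) ->
  (forall i, u i <= v i) -> iprod u <= iprod v.
Proof.
move=> u0 v1 uv.
have u01 i : 0 <= u i <= 1 by rewrite u0 (le_trans (uv i)).
have v01 i : 0 <= v i <= 1 by rewrite v1 (le_trans (u0 i)).
apply: ler_lim (cvgP _ (iprod_cvg u01)) (cvgP _ (iprod_cvg v01)) _.
by apply: nearW => n; apply: ler_prod => i _; rewrite u0 uv.
Qed.

Lemma iprodM u v : (forall i, 0 <= u i <= 1) -> (forall i, 0 <= v i <= 1) ->
  iprod (fun i => u i * v i) = iprod u * iprod v.
Proof.
move=> u01 v01; apply/cvg_lim => //.
under eq_fun do rewrite big_split.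
exact: cvgM (iprod_cvg u01) (iprod_cvg v01).
Qed.

Lemma iprod1 : iprod (fun=> 1) = 1.
Proof.
apply/cvg_lim => //; under eq_fun do rewrite big1//.
exact: cvg_cst.
Qed.

Lemma iprod_prod n (u : 'I_n -> nat -> R) : (forall l i, 0 <= u l i <= 1) ->
  iprod (fun i => \prod_(l < n) u l i) = \prod_(l < n) iprod (u l).
Proof.
elim: n u => [|n IH] u u01.
  by rewrite big_ord0 -[RHS]iprod1; congr iprod; apply/funext => i; rewrite big_ord0.
rewrite big_ord_recr/= -IH// -iprodM//.
  by congr iprod; apply/funext => i; rewrite big_ord_recr.
move=> i; apply/andP; split.
  by apply: prodr_ge0 => l _; have /andP[] := u01 (widen_ord (leqnSn n) l) i.
by apply: prodr_ile1 => l _; exact: u01.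
Qed.

End InfiniteProduct.

Section MeasurableIprod.
Context {R : realType} {d : measure_display} {T : measurableType d}.
Variables (U : nat -> T -> R).
Hypotheses (mU : forall i, measurable_fun setT (U i))
  (U01 : forall i w, 0 <= U i w <= 1).

Lemma measurable_iprod : measurable_fun setT (fun w => iprod (U ^~ w)).
Proof.
apply: (@measurable_fun_cvg _ _ _ _ (fun n w => \prod_(i < n) U i w)).
  by move=> n; apply: measurable_prod => i _; exact: mU.
by move=> w _; exact: iprod_cvg.
Qed.

(** Dominated convergence: the partial products are bounded by 1, which is integrable for a
    probability. *)
Lemma integral_iprod (P : probability T R) (c : nat -> R) :
  (forall i, 0 <= c i <= 1) ->
  (forall n, \int[P]_w (\prod_(i < n) U i w)%:E = (\prod_(i < n) c i)%:E)%E ->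
  (\int[P]_w (iprod (U ^~ w))%:E = (iprod c)%:E)%E.
Proof.
move=> c01 Uc.
have mprod n : measurable_fun setT (fun w => \prod_(i < n) U i w).
  by apply: measurable_prod => i _; exact: mU.
have [|||||_ _ cv] := @dominated_convergence _ _ _ P setT measurableT
  (fun n w => (\prod_(i < n) U i w)%:E) (fun w => (iprod (U ^~ w))%:E) (cst 1%E).
- by move=> n; exact/measurable_EFinP.
- exact/measurable_EFinP/measurable_iprod.
- by apply: aeW => w _; apply: cvg_EFin; [exact: nearW|exact: iprod_cvg].
- exact: finite_measure_integrable_cst.
- apply: aeW => w n _; rewrite /= lee_fin ger0_norm.
    by have /andP[] := prod_01 n (U01 ^~ w).
  by have /andP[] := prod_01 n (U01 ^~ w).
rewrite -(cvg_lim _ cv)//; apply/cvg_lim => //.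
rewrite [X in X @ _ --> _](_ : _ = fun n => (\prod_(i < n) c i)%:E); last first.
  by apply/funext => n /=; exact: Uc.
by apply: cvg_EFin; [exact: nearW|exact: iprod_cvg].
Qed.
End MeasurableIprod.

Section PgfPow.
Context {R : realType}.
Variable s : R.
Hypothesis s01 : 0 <= s <= 1.

Lemma pgf_pow0 : pgf_pow s 0%E = 1.
Proof. by rewrite /pgf_pow/= powRr0. Qed.

Lemma pgf_pow_01 x : (0 <= x)%E -> 0 <= pgf_pow s x <= 1.
Proof.
move: s01 => /andP[s0 s1]; case: x => [y||]//=; last first.
  by move=> _; case: ifP; rewrite ?ler01 ?lexx.
rewrite lee_fin => y0; have y1 : 1 `^ y = 1 :> R by rewrite powR1.
rewrite powR_ge0/= -[leRHS]y1.
by apply: ge0_ler_powR => //; rewrite nnegrE.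
Qed.

Lemma pgf_powD x y : (0 <= x)%E -> (0 <= y)%E ->
  pgf_pow s (x + y)%E = pgf_pow s x * pgf_pow s y.
Proof.
have pgfy z : (0 <= z)%E -> pgf_pow s (+oo + z)%E = pgf_pow s +oo%E * pgf_pow s z.
  case: z => [z||]//=.
    by case: eqP => [->|_]; rewrite ?powR1/= ?mulr1 ?mul0r.
  by case: eqP => _; rewrite ?mulr1 ?mul0r.
case: x y => [x||] [y||]// x0 y0; last 3 first.
- by rewrite addeC [LHS]pgfy// mulrC.
- by rewrite [LHS]pgfy.
- by rewrite [LHS]pgfy.
rewrite !lee_fin in x0 y0.
(* The exponent rule of [powR] fails at base 0 only when exponents cancel (0 to the power 0 is 1);
   nonnegative exponents cancel only if both vanish. *)
rewrite /=; have [s0|s0] := eqVneq s 0; last by rewrite powRD// s0 implybT.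
have [->|xn0] := eqVneq x 0; first by rewrite add0r powRr0 mul1r.
by rewrite powRD// paddr_eq0// (negbTE xn0).
Qed.

Lemma pgf_pow_sum (x : nat -> \bar R) n : (forall i, 0 <= x i)%E ->
  pgf_pow s (\sum_(i < n) x i)%E = \prod_(i < n) pgf_pow s (x i).
Proof.
move=> x0; elim: n => [|n IH]; first by rewrite !big_ord0 pgf_pow0.
by rewrite !big_ord_recr/= pgf_powD ?IH// sume_ge0.
Qed.

Lemma pgf_pow_le x y : (0 <= x)%E -> (x <= y)%E -> pgf_pow s y <= pgf_pow s x.
Proof.
move=> x0 xy; have [xfin|] := boolP (x \is a fin_num); last first.
  by rewrite fin_numE; case: x x0 xy => //= _; case: y.
have yx : (0 <= y - x)%E by rewrite sube_ge0 ?xfin ?orbT.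
rewrite -(subeK y xfin) pgf_powD// ler_piMl//; first by have /andP[] := pgf_pow_01 x0.
by have /andP[] := pgf_pow_01 yx.
Qed.

(** The bound [S n <= l] matters at [s = 0], where the power jumps from 1 at exponent 0 to 0 at
    positive exponents: for [l = 0] it forces every [S n] to be 0. *)
Lemma pgf_pow_cvg (S : nat -> \bar R) (l : \bar R) :
  (forall n, 0 <= S n)%E -> (forall n, S n <= l)%E -> S @ \oo --> l ->
  (fun n => pgf_pow s (S n)) @ \oo --> pgf_pow s l.
Proof.
move=> S0 Sl cS; have [s1|s1] := eqVneq s 1.
  have pgf1 x : (0 <= x)%E -> pgf_pow s x = 1.
    by rewrite s1; case: x => [x||]//= _; rewrite ?powR1 ?eqxx.
  rewrite pgf1 ?(le_trans (S0 0%N))//.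
  by under eq_fun do rewrite pgf1//; exact: cvg_cst.
have /andP[s0 s1'] := s01.
have slt1 : s < 1 by rewrite lt_neqAle s1.
case: l Sl cS => [l||] Sl cS; last first.
- by have := le_trans (S0 0%N) (Sl 0%N).
- rewrite /= (negbTE s1); apply/cvgrPdist_le => /= e e0.
  have : (fun n => s ^+ n) @ \oo --> 0 by apply: cvg_expr; rewrite ger0_norm.
  move=> /cvgrPdist_le /(_ e e0) [N _ /(_ N (leqnn N))] /=.
  rewrite sub0r normrN ger0_norm ?exprn_ge0// => sN.
  move/cvgeyPge : cS => /(_ N%:R); apply: filterS => n NS.
  rewrite sub0r normrN ger0_norm; last by have /andP[] := pgf_pow_01 (S0 n).
  apply: le_trans sN; rewrite -powR_mulrn//.
  by rewrite -[leRHS]/(pgf_pow s N%:R%:E) pgf_pow_le// lee_fin.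
- have Sfin n : S n \is a fin_num.
    by rewrite ge0_fin_numE// (le_lt_trans (Sl n))// ltry.
  have [s00|sn0] := eqVneq s 0.
    have [l0|ln0] := eqVneq l 0.
      have S00 n : S n = 0%E by apply/eqP; rewrite eq_le S0 andbT; have := Sl n; rewrite l0.
      by rewrite l0 pgf_pow0; under eq_fun do rewrite S00 pgf_pow0; exact: cvg_cst.
    have l0 : 0 < l.
      by rewrite lt_neqAle eq_sym ln0 -lee_fin (le_trans (S0 0%N) (Sl 0%N)).
    rewrite /= s00 powR0//; apply: cvg_near_cst.
    have : \forall n \near \oo, 0 < fine (S n) by apply: (cvgr_gt l) => //; exact: fine_cvg.
    by apply: filterS => n Sn; rewrite -(fineK (Sfin n)) /= powR0// gt_eqF.
  have sE x : x \is a fin_num -> pgf_pow s x = expR (fine x * ln s).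
    by move=> xfin; rewrite -(fineK xfin)/= /powR (negbTE sn0).
  rewrite sE//; under eq_fun do rewrite sE//.
  apply: continuous_cvg; first exact: continuous_expR.
  by apply: cvgMl; apply: fine_cvg.
Qed.

Lemma pgf_pow_series (x : nat -> \bar R) : (forall i, 0 <= x i)%E ->
  pgf_pow s (\sum_(i <oo) x i)%E = iprod (fun i => pgf_pow s (x i)).
Proof.
move=> x0; apply/esym/cvg_lim => //.
under eq_fun do rewrite -pgf_pow_sum//.
apply: pgf_pow_cvg.
- by move=> n; exact: sume_ge0.
- by move=> n; rewrite -(big_mkord xpredT x); exact: nneseries_lim_ge.
- have := @is_cvg_nneseries _ x xpredT 0%N (fun n _ _ => x0 n).
  by under eq_fun do rewrite big_mkord.
Qed.
End PgfPow.

(** * Expectations of products over independent blocks of families *)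

Section IndependentBlocks.
Context {R : realType} {d : measure_display} {T : measurableType d}.
Variable P : probability T R.
Variables (I : eqType) (G : I -> set (set T)).
Hypothesis mG : forall i A, G i A -> measurable A.
Hypothesis indG : mutually_independent P G.

Local Notation sg K := (g_sigma_algebraType (\bigcup_(k in K) G k)).

Lemma measurable_bigcup_families (K : set I) A :
  (\bigcup_(k in K) G k) A -> measurable A.
Proof. by move=> [k _]; exact: mG. Qed.

Lemma measurable_fun_subfamilies d' (Y : measurableType d') (K K' : set I)
    (f : T -> Y) : K `<=` K' ->
  measurable_fun setT (f : sg K -> Y) -> measurable_fun setT (f : sg K' -> Y).
Proof.
move=> KK' mf _ B mB; have := mf measurableT B mB.
rewrite !setTI; apply: sub_sigma_algebra2.
by move=> A [k Kk GA]; exists k => //; exact: KK'.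
Qed.

Variables (K : nat -> set I) (U : nat -> T -> R) (c : nat -> R).
Hypotheses (disjK : forall i j, i != j -> K i `&` K j = set0)
  (mU : forall i, measurable_fun setT (U i : sg (K i) -> R))
  (U01 : forall i w, 0 <= U i w <= 1)
  (Uc : forall i, (\int[P]_w (U i w)%:E = (c i)%:E)%E).

(** Induction on [n]: block [n] is disjoint from the union of the earlier blocks, so decoupling
    splits off the last factor. *)
Lemma integral_prod_blocks n :
  (\int[P]_w (\prod_(i < n) U i w)%:E = (\prod_(i < n) c i)%:E)%E.
Proof.
elim: n => [|n IH].
  under eq_integral do rewrite big_ord0.
  by rewrite big_ord0 integral_cst// mul1e; exact: probability_setT.
pose Kn := \bigcup_(i in [set i | (i < n)%N]) K i.
have dKn : Kn `&` K n = set0.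
  apply/seteqP; split => // k [[i /= ltin Kik] Knk].
  have : (K i `&` K n) k by [].
  by rewrite disjK// (ltn_eqF ltin).
have mV : measurable_fun setT ((fun w => \prod_(i < n) U i w) : sg Kn -> R).
  apply: measurable_prod => i _; apply: (measurable_fun_subfamilies _ (@mU i)).
  by move=> k Kik; exists i => //=.
have V0 w : 0 <= \prod_(i < n) U i w by have /andP[] := prod_01 n (U01 ^~ w).
transitivity (\int[P]_w ((\prod_(i < n) U i w) * U n w)%:E)%E.
  by apply: eq_integral => w _; rewrite big_ord_recr.
have /= -> := @decoupling _ _ _ P _ _ (@measurable_bigcup_families Kn)
  (@measurable_bigcup_families (K n)) (disjoint_indep_families mG indG dKn)
  (fun z => ((\prod_(i < n) U i z.1) * U n z.2)%:E).
- have mVP := measurable_fun_g_sigma (@measurable_bigcup_families Kn) mV.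
  have mUP := measurable_fun_g_sigma (@measurable_bigcup_families (K n)) (@mU n).
  under eq_integral => w _.
    under eq_integral do rewrite EFinM.
    rewrite ge0_integralZl_EFin//; last 2 first.
    - by move=> w' _; rewrite lee_fin; have /andP[] := U01 n w'.
    - exact/measurable_EFinP.
    rewrite Uc muleC; over.
  rewrite /= ge0_integralZl_EFin//; last 3 first.
  - by move=> w _; rewrite lee_fin.
  - exact/measurable_EFinP.
  - rewrite -lee_fin -Uc; apply: integral_ge0 => w _; rewrite lee_fin.
    by have /andP[] := U01 n w.
  by rewrite IH big_ord_recr/= -EFinM mulrC.
- by move=> z; rewrite lee_fin mulr_ge0//; have /andP[] := U01 n z.2.
- apply/measurable_EFinP; apply: measurable_funM.
    exact: (measurableT_comp mV).
  exact: (measurableT_comp (@mU n)).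
Qed.

(** Meant for use with the first sample point frozen: the factor of label [i] then depends on the
    second one only through the block [K i]. *)
Lemma integral_iprod_blocks : (\int[P]_w (iprod (U ^~ w))%:E = (iprod c)%:E)%E.
Proof.
have mUT i : measurable_fun setT (U i).
  exact: (measurable_fun_g_sigma (@measurable_bigcup_families (K i)) (@mU i)).
apply: integral_iprod => //; last exact: integral_prod_blocks.
move=> i; rewrite -!lee_fin -Uc; apply/andP; split.
  by apply: integral_ge0 => w _; rewrite lee_fin; have /andP[] := U01 i w.
have <- : (\int[P]_w (cst 1%E) w = 1%E)%E.
  by rewrite integral_cst// mul1e; exact: probability_setT.
apply: ge0_le_integral => //.
- by move=> w _; rewrite lee_fin; have /andP[] := U01 i w.
- exact/measurable_EFinP.
- by move=> w _; rewrite lee_fin; have /andP[] := U01 i w.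
Qed.

End IndependentBlocks.

(** * Expectations computed from a joint law of counts in product form *)

Section JointLaw.
Context {R : realType} {d : measure_display} {T : measurableType d}.
Variable P : probability T R.
Variables (N : nat -> T -> \bar R) (p : nat -> nat -> R).
Hypotheses (mN : forall l k, measurable [set w | N l w = k%:R%:E])
  (N_nat : forall l, P (\bigcup_k [set w | N l w = k%:R%:E]) = 1%E)
  (p0 : forall l k, 0 <= p l k).

(* The set A is what makes the induction on n work: the step conditions on
   N n = j by shrinking A. *)
Lemma integral_prod_joint_law (phi : nat -> \bar R -> R) (e : nat -> R) :
  (forall l, measurable_fun setT (fun w => phi l (N l w))) ->
  (forall l w, 0 <= phi l (N l w)) ->
  (forall l k, 0 <= phi l k%:R%:E) ->
  (forall l, (\sum_(k <oo) (phi l k%:R%:E * p l k)%:E = (e l)%:E)%E) ->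
  forall n (A : set T) (c : R), measurable A -> 0 <= c ->
  (forall k : nat -> nat, P (A `&` [set w | forall l, (l < n)%N ->
     N l w = (k l)%:R%:E]) = (c * \prod_(l < n) p l (k l))%:E) ->
  (\int[P]_(w in A) (\prod_(l < n) phi l (N l w))%:E =
   (c * \prod_(l < n) e l)%:E)%E.
Proof.
move=> mphi phiN0 phi0 phie; elim=> [|n IH] A c mA c0 PA.
  under eq_integral do rewrite big_ord0.
  rewrite integral_cst// mul1e big_ord0 mulr1.
  have := PA (fun=> 0%N); rewrite big_ord0 mulr1 => <-; congr (P _).
  by apply/seteqP; split => // w Aw; split.
pose D j := [set w | N n w = j%:R%:E].
have mD j : measurable (D j) by exact: mN.
have mUD : measurable (\bigcup_j D j) by exact: bigcupT_measurable.
have PDC : P (~` \bigcup_j D j) = 0%E.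
  by rewrite probability_setC// N_nat subee.
have phiprod0 m w : 0 <= \prod_(l < m) phi l (N l w) by exact: prodr_ge0.
have mprod m : measurable_fun setT (fun w => (\prod_(l < m) phi l (N l w))%:E).
  by apply/measurable_EFinP; apply: measurable_prod => l _; exact: mphi.
(* The events [D j] cover the space only up to a null set: the count may be infinite there. *)
have -> : (\int[P]_(w in A) (\prod_(l < n.+1) phi l (N l w))%:E =
  \int[P]_(w in \bigcup_j (A `&` D j)) (\prod_(l < n.+1) phi l (N l w))%:E)%E.
  rewrite -setI_bigcupr [LHS](@ge0_negligible_integral _ _ _ _ _ (~` \bigcup_j D j))//.
  - by rewrite setDE setCK.
  - exact: measurableC.
  - exact: measurable_funTS.
  - by move=> w _; rewrite lee_fin.
rewrite ge0_integral_bigcup//; last 4 first.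
- by move=> j; exact: measurableI.
- exact: measurable_funTS.
- by move=> w _; rewrite lee_fin.
- apply/trivIsetP => i j _ _ ij; apply/seteqP; split => // w [[_ +] [_]].
  rewrite /D/= => -> [] /eqP; rewrite eqr_nat => /eqP ij'.
  by rewrite ij' eqxx in ij.
have -> : (c * \prod_(l < n.+1) e l)%:E =
    ((c * \prod_(l < n) e l)%:E * \sum_(k <oo) (phi n k%:R%:E * p n k)%:E)%E.
  by rewrite phie -EFinM big_ord_recr/= mulrA.
rewrite -nneseriesZl; last first.
  by move=> k _; rewrite lee_fin mulr_ge0.
apply: eq_eseriesr => j _.
transitivity (\int[P]_(w in A `&` D j)
   ((phi n j%:R%:E)%:E * (\prod_(l < n) phi l (N l w))%:E))%E.
  apply: eq_integral => w; rewrite inE => -[_ Djw].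
  by rewrite big_ord_recr/= Djw EFinM muleC.
rewrite ge0_integralZl_EFin//; last 3 first.
- exact: measurableI.
- by move=> w _; rewrite lee_fin.
- exact: measurable_funTS.
rewrite (IH _ (c * p n j)).
- by rewrite -!EFinM; congr EFin; ring.
- exact: measurableI.
- by rewrite mulr_ge0.
move=> k; have := PA (fun l => if l == n then j else k l).
rewrite big_ord_recr/= eqxx => PAj.
transitivity (P (A `&` [set w | forall l, (l < n.+1)%N ->
     N l w = (if l == n then j else k l)%:R%:E])).
  congr (P _); apply/seteqP; split => w /=.
    move=> [[Aw Dw] h]; split => // l; rewrite ltnS leq_eqVlt.
    by case: eqP => [->|_] //= ln; exact: h.
  move=> [Aw h]; split.
    by split => //; have := h n (ltnSn n); rewrite eqxx.
  by move=> l ln; have := h l (ltnW ln); rewrite (ltn_eqF ln).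
rewrite PAj; congr EFin; rewrite [X in c * X]mulrC mulrA; congr (_ * _).
by apply: eq_bigr => l _; rewrite (ltn_eqF (ltn_ord l)).
Qed.

End JointLaw.

Section PoissonPgf.
Context {R : realType}.

(** The exponential series at [v * mu], scaled by [expR (- mu)]. At [v = 1] it says that the masses
    sum to 1, whence counts of sets of finite intensity are almost surely finite. *)
Lemma poisson_pgf (mu v : R) : 0 <= mu -> 0 <= v ->
  (\sum_(k <oo) (v ^+ k * poisson_mass mu k)%:E = (expR (mu * (v - 1)))%:E)%E.
Proof.
move=> mu0 v0.
rewrite (_ : expR _ = expR (- mu) * expR (v * mu)); last first.
  by rewrite -expRD; congr expR; rewrite mulrBr mulr1 addrC mulrC.
under eq_eseriesr => k _.
  rewrite (_ : _ * _ = expR (- mu) * exp_coeff (v * mu) k); last first.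
    by rewrite /poisson_mass /exp_coeff/= exprMn !mulrA mulrC !mulrA.
  rewrite EFinM; over.
rewrite /= nneseriesZl/=; last first.
  by move=> k _; rewrite lee_fin /exp_coeff/= divr_ge0// exprn_ge0// mulr_ge0.
rewrite EFinM; congr (_ * _)%E.
rewrite expRE -EFin_lim; last first.
  rewrite /pseries/=; under eq_fun do rewrite mulrC.
  exact: is_cvg_series_exp_coeff.
apply/congr_lim/funext => n/=; rewrite /pseries/= /series/= -sumEFin//.
by under eq_bigr do rewrite /exp_coeff/= mulrC.
Qed.

Lemma poisson_mass_ge0 (mu : R) k : 0 <= mu -> 0 <= poisson_mass mu k.
Proof. by move=> mu0; rewrite mulr_ge0 ?expR_ge0// divr_ge0// exprn_ge0. Qed.

End PoissonPgf.

(** * The Poisson functional *)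

Section PoissonFunctional.
Context {R : realType} {d : measure_display} {T : measurableType d}.
Context {dX : measure_display} {X : measurableType dX}.
Variables (P : probability T R) (pres : nat -> T -> bool) (pos : nat -> T -> X).

(** The product of [f] over the points that are present; its expectation is the probability
    generating functional of the process. *)
Definition ppprod (f : X -> R) (w : T) : R :=
  iprod (fun i => if pres i w then f (pos i w) else 1).

(** Exchanging the product over labels with the one over cells collects, for each cell, as many
    factors [v l] as it has points. This is the passage from random products to counts. *)
Lemma ppprod_step n (B : nat -> set X) (v : nat -> R) w :
  (forall l, 0 <= v l <= 1) ->
  ppprod (fun x => \prod_(l < n) (if `[< B l x >] then v l else 1)) w =
  \prod_(l < n) pgf_pow (v l) (pp_count pres pos w (B l)).
Proof.
move=> v01; rewrite /ppprod.
rewrite [LHS](_ : _ = iprod (fun i => \prod_(l < n)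
  (if pres i w && `[< B l (pos i w) >] then v l else 1))); last first.
  congr iprod; apply/funext => i; case: (pres i w) => //=.
  by rewrite big1.
rewrite iprod_prod => [|l i]; last by case: ifP => // _; rewrite ler01 lexx.
apply: eq_bigr => l _; rewrite /pp_count pgf_pow_series//.
congr iprod; apply/funext => i; case: ifP => _ /=; last by rewrite powRr0.
by rewrite powRr1//; have /andP[] := v01 l.
Qed.

Hypotheses (mpres : forall i, measurable [set w | pres i w])
  (mpos : forall i, measurable_fun setT (pos i)).

Lemma measurable_pp_indic i B : measurable B ->
  measurable_fun setT (fun w => (pres i w && `[< B (pos i w) >])%:R : R).
Proof.
move=> mB; have mA : measurable ([set w | pres i w] `&` pos i @^-1` B).
  by apply: measurableI => //; rewrite -[X in measurable X]setTI; exact: mpos.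
rewrite (_ : (fun w => _) = \1_([set w | pres i w] `&` pos i @^-1` B)).
  exact: measurable_indic.
apply/funext => w; rewrite indicE; congr ((nat_of_bool _)%:R).
apply/idP/idP => [/andP[pw /asboolP Bw]|]; first by rewrite inE; split.
by rewrite inE => -[pw Bw]; apply/andP; split => //; exact/asboolP.
Qed.

Lemma measurable_pp_count B : measurable B ->
  measurable_fun setT (fun w => pp_count (R := R) pres pos w B).
Proof.
move=> mB; apply: ge0_emeasurable_sum => //= i _.
by apply/measurable_EFinP; exact: measurable_pp_indic.
Qed.

Lemma measurable_pp_factor i (f : X -> R) : measurable_fun setT f ->
  measurable_fun setT (fun w => if pres i w then f (pos i w) else 1).
Proof.
move=> mf; apply: measurable_fun_ifT => //.
  by apply: (@measurable_fun_bool _ _ _ _ true); rewrite setTI; exact: mpres.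
exact: (measurableT_comp mf (@mpos i)).
Qed.

Lemma measurable_ppprod (f : X -> R) : measurable_fun setT f ->
  (forall x, 0 <= f x <= 1) -> measurable_fun setT (ppprod f).
Proof.
move=> mf f01; apply: measurable_iprod => i; first exact: measurable_pp_factor.
by move=> w; case: ifP => // _; rewrite ler01 lexx.
Qed.

Lemma ppprod_01 (f : X -> R) w : (forall x, 0 <= f x <= 1) ->
  0 <= ppprod f w <= 1.
Proof.
move=> f01; apply: iprod_01 => i.
by case: ifP => // _; rewrite ler01 lexx.
Qed.

Lemma ppprod_le (f g : X -> R) w : (forall x, 0 <= f x) ->
  (forall x, g x <= 1) -> (forall x, f x <= g x) -> ppprod f w <= ppprod g w.
Proof.
by move=> f0 g1 fg; apply: iprod_le => i; case: ifP.
Qed.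

Variable mu : {measure set X -> \bar R}.
Hypothesis ppp : pp_is_PPP P pres pos mu.

(** Counts of disjoint cells have a product Poisson law, so each cell contributes its Poisson
    generating function [expR (mu * (v - 1))]. *)
Lemma integral_ppprod_step n (B : nat -> set X) (v : nat -> R) :
  (forall l, measurable (B l)) -> (forall l, (mu (B l) < +oo)%E) ->
  (forall l l', l != l' -> B l `&` B l' = set0) ->
  (forall l, 0 <= v l <= 1) ->
  (\int[P]_w (ppprod (fun x =>
     \prod_(l < n) (if `[< B l x >] then v l else 1%R)) w)%:E =
   (expR (\sum_(l < n) fine (mu (B l)) * (v l - 1)))%:E)%E.
Proof.
move=> mB finB disjB v01.
pose m l := fine (mu (B l)).
have m0 l : 0 <= m l by exact: fine_ge0.
pose N l w := pp_count (R := R) pres pos w (B l).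
have N0 l w : (0 <= N l w)%E by apply: nneseries_ge0.
have mNk l k : measurable [set w | N l w = k%:R%:E].
  have := @measurable_pp_count _ (mB l) measurableT _ (emeasurable_set1 k%:R%:E).
  by rewrite setTI.
have law n' (k : nat -> nat) : P [set w | forall l, (l < n')%N -> N l w = (k l)%:R%:E] =
    (\prod_(l < n') poisson_mass (m l) (k l))%:E.
  have [_ [_ /(_ n' (fun l => B l) (fun l => k l))]] := ppp.
  rewrite prodEFin => <- //; last by move=> l l' ll'; exact: disjB.
  congr (P _); apply/seteqP; split => w /=; first by move=> h l _; exact: h.
  by move=> h l ln; exact: (h (Ordinal ln)).
have law1 l k : P [set w | N l w = k%:R%:E] = (poisson_mass (m l) k)%:E.
  have [_ [_ /(_ 1%N (fun=> B l) (fun=> k))]] := ppp.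
  rewrite big_ord1 => <- //; last by move=> i j; rewrite !ord1.
  by congr (P _); apply/seteqP; split => w /= h; [move=> ? _|exact: (h ord0)].
under eq_integral do rewrite ppprod_step//.
rewrite -[RHS]mul1e expR_sum -EFinM.
apply: (@integral_prod_joint_law _ _ _ P N (fun l => poisson_mass (m l)) _ _ _
  (fun l => pgf_pow (v l)) (fun l => expR (m l * (v l - 1)))) => //.
- move=> l; rewrite measure_bigcup//=; last first.
    apply/trivIsetP => i j _ _ ij; apply/seteqP; split => // w /= [->] [/eqP].
    by rewrite eqr_nat (negbTE ij).
  rewrite (eq_eseriesr (fun k _ => law1 l k)).
  have := @poisson_pgf _ (m l) 1 (m0 l) ler01.
  rewrite subrr mulr0 expR0 => <-.
  rewrite (@eq_eseriesl _ _ xpredT); last by move=> k; rewrite in_setT.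
  apply: eq_eseriesr => k _.
  by rewrite expr1n mul1r.
- by move=> l k; exact: poisson_mass_ge0.
- move=> l; rewrite /pgf_pow.
  (* Measurability is checked label by label: the power of a count is an infinite product of factors
     that are affine in indicators. *)
  rewrite (_ : (fun w => _) = fun w => iprod (fun i =>
     pgf_pow (v l) (pres i w && `[< B l (pos i w) >])%:R%:E)); last first.
    by apply/funext => w; rewrite -pgf_pow_series.
  apply: measurable_iprod => [i|i w]; last by apply: pgf_pow_01.
  rewrite (_ : (fun w => _) = fun w => 1 - (1 - v l) *
      (pres i w && `[< B l (pos i w) >])%:R); last first.
    apply/funext => w; case: (_ && _) => /=.
      by rewrite powRr1 ?mulr1 ?subKr//; have /andP[] := v01 l.
    by rewrite powRr0 mulr0 subr0.
  apply: measurable_funB => //; apply: measurable_funM => //.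
  exact: measurable_pp_indic.
- by move=> l w; have /andP[] := pgf_pow_01 (v01 l) (N0 l w).
- by move=> l k; have /andP[] := @pgf_pow_01 _ (v l) (v01 l) k%:R%:E (ler0n R k).
- move=> l; have /andP[v0 _] := v01 l; rewrite -poisson_pgf//.
  by apply: eq_eseriesr => k _; rewrite /= powR_mulrn.
- by move=> k; rewrite setTI mul1r; exact: law.
Qed.

Lemma prod_step n (B : nat -> set X) (v : nat -> R) x l0 :
  (forall l l', l != l' -> B l `&` B l' = set0) -> (l0 < n)%N -> B l0 x ->
  \prod_(l < n) (if `[< B l x >] then v l else 1) = v l0.
Proof.
move=> disjB l0n Bx; rewrite (bigD1 (Ordinal l0n))//= asboolT// big1 ?mulr1//.
move=> i il0; rewrite asboolF// => Bi.
by have : (B i `&` B l0) x by []; rewrite disjB.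
Qed.

Lemma sum_step n (B : nat -> set X) (c : nat -> R) x l0 :
  (forall l l', l != l' -> B l `&` B l' = set0) -> (l0 < n)%N -> B l0 x ->
  \sum_(l < n) c l * \1_(B l) x = c l0.
Proof.
move=> disjB l0n Bx; rewrite (bigD1 (Ordinal l0n))//= big1 ?addr0.
  by rewrite indicE mem_set// mulr1.
move=> i il0; rewrite indicE memNset ?mulr0// => Bi.
by have : (B i `&` B l0) x by []; rewrite disjB.
Qed.

Lemma integral_sum_step n (B : nat -> set X) (c : nat -> R) :
  (forall l, measurable (B l)) -> (forall l, (mu (B l) < +oo)%E) ->
  (forall l, 0 <= c l) ->
  (\int[mu]_x (\sum_(l < n) c l * \1_(B l) x)%:E =
   (\sum_(l < n) fine (mu (B l)) * c l)%:E)%E.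
Proof.
move=> mB finB c0.
under eq_integral do rewrite -sumEFin.
rewrite ge0_integral_sum//; last 2 first.
- by move=> l; apply/measurable_EFinP; exact: measurable_funM.
- by move=> l x _; rewrite lee_fin mulr_ge0.
rewrite -sumEFin; apply: eq_bigr => l _.
under eq_integral do rewrite EFinM.
rewrite ge0_integralZl_EFin//; last first.
  by apply/measurable_EFinP.
by rewrite integral_indic// setIT EFinM fineK ?ge0_fin_numE// muleC.
Qed.

Lemma step_01 n (B : nat -> set X) (v : nat -> R) x :
  (forall l, 0 <= v l <= 1) ->
  0 <= \prod_(l < n) (if `[< B l x >] then v l else 1) <= 1.
Proof.
move=> v01; apply: (prod_01 n (u := fun l => if `[< B l x >] then v l else 1)).
by move=> l; case: ifP => // _; rewrite ler01 lexx.
Qed.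

Lemma measurable_step n (B : nat -> set X) (v : nat -> R) :
  (forall l, measurable (B l)) ->
  measurable_fun setT (fun x => \prod_(l < n) (if `[< B l x >] then v l else 1)).
Proof.
move=> mB; apply: measurable_prod => l _; apply: measurable_fun_ifT => //.
apply: (@measurable_fun_bool _ _ _ _ true); rewrite setTI.
rewrite (_ : _ @^-1` _ = B l)//.
by apply/seteqP; split => x /=; [move/asboolP|move/asboolP].
Qed.

(** Lower and upper step functions differ by [1 / n.+1] on level sets inside [K], so their exponents
    differ by at most [mu K / n.+1]. Finite intensity of [K] makes this error vanish and lets the
    count law apply to the level sets. *)
Lemma integral_ppprod (f : X -> R) (K : set X) :
  measurable_fun setT f -> (forall x, 0 <= f x <= 1) ->
  measurable K -> (mu K < +oo)%E -> (forall x, ~ K x -> f x = 1) ->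
  (\int[P]_w (ppprod f w)%:E =
   (expR (- fine (\int[mu]_x (1 - f x)%:E)))%:E)%E.
Proof.
move=> mf f01 mK finK f1.
have f0 x : 0 <= f x by have /andP[] := f01 x.
have fle1 x : f x <= 1 by have /andP[] := f01 x.
pose M := fine (mu K).
have MK : M%:E = mu K by rewrite fineK// ge0_fin_numE.
pose J := fine (\int[mu]_x (1 - f x)%:E).
have m1f : measurable_fun setT (fun x => (1 - f x)%:E).
  by apply/measurable_EFinP; exact: measurable_funB.
have J0 : (0 <= \int[mu]_x (1 - f x)%:E)%E.
  by apply: integral_ge0 => x _; rewrite lee_fin subr_ge0.
pose E := fine (\int[P]_w (ppprod f w)%:E).
have mppf : measurable_fun setT (fun w => (ppprod f w)%:E).
  by apply/measurable_EFinP; exact: measurable_ppprod.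
have EE : (\int[P]_w (ppprod f w)%:E = E%:E)%E.
  rewrite fineK// ge0_fin_numE; last first.
    by apply: integral_ge0 => w _; rewrite lee_fin; have /andP[] := ppprod_01 w f01.
  apply: (@le_lt_trans _ _ (\int[P]_w (cst 1%E) w)%E).
    apply: ge0_le_integral => //.
    - by move=> w _; rewrite lee_fin; have /andP[] := ppprod_01 w f01.
    - by move=> w _; rewrite lee_fin; have /andP[] := ppprod_01 w f01.
  by rewrite integral_cst// mul1e (le_lt_trans (probability_le1 _ _))// ltry.
(* Squeeze f between the step functions with values l / n.+1 and l.+1 / n.+1
   on the level sets B l. *)
have key n : expR (- J - M / n.+1%:R) <= E <= expR (- J + M / n.+1%:R).
  pose B l := K `&` f @^-1` `[l%:R / n.+1%:R, l.+1%:R / n.+1%:R[.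
  have n0 : 0 < n.+1%:R :> R by rewrite ltr0n.
  have mB l : measurable (B l).
    by apply: measurableI => //; rewrite -[X in measurable X]setTI; exact: mf.
  have BK l : (mu (B l) <= mu K)%E by apply: le_measure; rewrite ?inE//; exact: subIsetl.
  have finB l : (mu (B l) < +oo)%E by exact: le_lt_trans finK.
  have disjB l l' : l != l' -> B l `&` B l' = set0.
    move=> ll'; apply/seteqP; split => // x [[_ Bl] [_ Bl']].
    move: Bl Bl'; rewrite /= !in_itv/= => /andP[a1 a2] /andP[b1 b2].
    rewrite !ler_pdivrMr// !ltr_pdivlMr// in a1 a2 b1 b2.
    have := le_lt_trans a1 b2; have := le_lt_trans b1 a2.
    rewrite !ltr_nat !ltnS => h1 h2.
    by move: ll'; rewrite eqn_leq h1 h2.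
  (* The cells are half-open, so the value 1 lies in none of the first [n.+1]. Such points need no
     cell: they contribute the factor 1 and the integrand 0. *)
  have Bcase x : (exists2 l, (l < n.+1)%N & B l x) \/
      (f x = 1 /\ forall l, (l < n.+1)%N -> ~ B l x).
    have [fx1|fx1] := eqVneq (f x) 1.
      right; split => // l ln [_ /=]; rewrite in_itv/= fx1 => /andP[_].
      by rewrite ltr_pdivlMr// mul1r ltr_nat ltnS leqNgt ln.
    left; have Kx : K x by apply: contrapT => /f1 /eqP; rewrite (negbTE fx1).
    have /andP[t1 t2] := truncn_itv (mulr_ge0 (f0 x) (ltW n0)).
    exists (Num.truncn (f x * n.+1%:R)).
      rewrite -(ltr_nat R) (le_lt_trans t1)// -[ltRHS]mul1r ltr_pM2r//.
      by rewrite lt_neqAle fx1 fle1.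
    by split => //=; rewrite in_itv/= ler_pdivrMr// ltr_pdivlMr// t1.
  (* The cap at 1 keeps the values in [0, 1] at every index, as the step lemma requires; it changes
     nothing for [l <= n.+1]. *)
  pose lo l : R := Num.min (l%:R / n.+1%:R) 1.
  pose hi l : R := lo l.+1.
  have lo01 l : 0 <= lo l <= 1.
    by rewrite /lo ge_min lexx orbT andbT le_min ler01 divr_ge0.
  have hi01 l : 0 <= hi l <= 1 by exact: lo01.
  have loE l : (l <= n.+1)%N -> lo l = l%:R / n.+1%:R.
    by move=> ln; apply/min_idPl; rewrite ler_pdivrMr// mul1r ler_nat.
  have floh x l : (l < n.+1)%N -> B l x -> lo l <= f x <= hi l.
    move=> ln [_ /=]; rewrite in_itv/= /hi !loE// 1?ltnW//.
    by move=> /andP[-> /ltW].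
  have Elo : expR (\sum_(l < n.+1) fine (mu (B l)) * (lo l - 1)) <= E.
    rewrite -lee_fin -EE -integral_ppprod_step//.
    apply: ge0_le_integral => //.
    - move=> w _; rewrite lee_fin; apply: (andP (ppprod_01 w _)).1 => x.
      exact: step_01.
    - apply/measurable_EFinP/measurable_ppprod; first exact: measurable_step.
      by move=> x; exact: step_01.
    - move=> w _; rewrite lee_fin; apply: ppprod_le => // x.
        by apply: prodr_ge0 => l _; case: ifP => // _; have /andP[] := lo01 l.
      have [[l ln Bl]|[-> nB]] := Bcase x.
        by rewrite (prod_step _ disjB ln Bl); have /andP[] := floh _ _ ln Bl.
      by rewrite big1// => l _; rewrite asboolF//; exact: nB.
  have Ehi : E <= expR (\sum_(l < n.+1) fine (mu (B l)) * (hi l - 1)).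
    rewrite -lee_fin -EE -integral_ppprod_step//.
    apply: ge0_le_integral => //.
    - by move=> w _; rewrite lee_fin; have /andP[] := ppprod_01 w f01.
    - apply/measurable_EFinP/measurable_ppprod; first exact: measurable_step.
      by move=> x; exact: step_01.
    - move=> w _; rewrite lee_fin; apply: ppprod_le => // x.
        by apply: prodr_ile1 => l; case: ifP; rewrite ?ler01 ?lexx.
      have [[l ln Bl]|[-> nB]] := Bcase x.
        by rewrite (prod_step _ disjB ln Bl); have /andP[] := floh _ _ ln Bl.
      by rewrite big1// => l _; rewrite asboolF//; exact: nB.
  have msum c : measurable_fun setT (fun x => (\sum_(l < n.+1) c l * \1_(B l) x)%:E).
    apply/measurable_EFinP; apply: measurable_sum => l.
    exact: measurable_funM.
  have Jhi : (\int[mu]_x (1 - f x)%:E <= (\sum_(l < n.+1) fine (mu (B l)) * (1 - lo l))%:E)%E.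
    rewrite -(@integral_sum_step _ B (fun l => 1 - lo l))//; last first.
      by move=> l; rewrite subr_ge0; have /andP[] := lo01 l.
    apply: ge0_le_integral => //.
    - by move=> x _; rewrite lee_fin subr_ge0.
    - move=> x _; rewrite lee_fin.
      have [[l ln Bl]|[-> nB]] := Bcase x.
        rewrite (@sum_step _ _ (fun l => 1 - lo l) _ _ disjB ln Bl) lerD2l lerN2.
        by have /andP[] := floh _ _ ln Bl.
      by rewrite subrr sumr_ge0// => l _; rewrite mulr_ge0// subr_ge0; have /andP[] := lo01 l.
  have Jlo : ((\sum_(l < n.+1) fine (mu (B l)) * (1 - hi l))%:E <= \int[mu]_x (1 - f x)%:E)%E.
    rewrite -(@integral_sum_step _ B (fun l => 1 - hi l))//; last first.
      by move=> l; rewrite subr_ge0; have /andP[] := hi01 l.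
    apply: ge0_le_integral => //.
    - move=> x _; rewrite lee_fin sumr_ge0// => l _.
      by rewrite mulr_ge0// subr_ge0; have /andP[] := hi01 l.
    - move=> x _; rewrite lee_fin.
      have [[l ln Bl]|[-> nB]] := Bcase x.
        rewrite (@sum_step _ _ (fun l => 1 - hi l) _ _ disjB ln Bl) lerD2l lerN2.
        by have /andP[] := floh _ _ ln Bl.
      by rewrite subrr big1// => l _; rewrite indicE memNset ?mulr0//; exact: nB.
  have JE : (\int[mu]_x (1 - f x)%:E = J%:E)%E.
    by rewrite fineK// ge0_fin_numE// (le_lt_trans Jhi)// ltry.
  rewrite JE !lee_fin in Jlo Jhi.
  have SM : \sum_(l < n.+1) fine (mu (B l)) <= M.
    have muK : (\int[mu]_x (\1_K x)%:E = mu K)%E by rewrite integral_indic// setIT.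
    rewrite -lee_fin MK -muK.
    rewrite (_ : \sum_(l < n.+1) _ = \sum_(l < n.+1) fine (mu (B l)) * 1); last first.
      by apply: eq_bigr => l _; rewrite mulr1.
    rewrite -(@integral_sum_step _ B (fun=> 1))//.
    apply: ge0_le_integral => //.
    - by move=> x _; rewrite lee_fin sumr_ge0// => l _; rewrite mulr_ge0.
    - exact/measurable_EFinP.
    - move=> x _; rewrite lee_fin.
      have [[l ln Bl]|[_ nB]] := Bcase x.
        rewrite (@sum_step _ _ (fun=> 1) _ _ disjB ln Bl) indicE mem_set//.
        by case: Bl.
      by rewrite big1// => l _; rewrite indicE memNset ?mulr0//; exact: nB.
  (* Each [hi l - lo l] equals [1 / n.+1], and the cells have total mass at most [M]. *)
  have Sdiff : \sum_(l < n.+1) fine (mu (B l)) * (1 - lo l) <=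
     \sum_(l < n.+1) fine (mu (B l)) * (1 - hi l) + M / n.+1%:R.
    apply: (@le_trans _ _ (\sum_(l < n.+1) fine (mu (B l)) * (1 - hi l) +
       (\sum_(l < n.+1) fine (mu (B l))) / n.+1%:R)); last first.
      by rewrite lerD2l ler_pM2r// invr_gt0.
    rewrite mulr_suml -big_split/= ler_sum// => l _.
    rewrite /hi (loE l (ltnW (ltn_ord l))) (loE l.+1 (ltn_ord l)).
    by rewrite -(@natr1 _ l) le_eqVlt; apply/orP; left; apply/eqP; ring.
  have SN (v : nat -> R) : \sum_(l < n.+1) fine (mu (B l)) * (v l - 1) =
      - \sum_(l < n.+1) fine (mu (B l)) * (1 - v l).
    by rewrite -sumrN; apply: eq_bigr => l _; rewrite -mulrN opprB.
  rewrite !SN in Elo Ehi.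
  apply/andP; split.
    apply: le_trans Elo; rewrite ler_expR -opprD lerN2.
    by apply: (le_trans Sdiff); rewrite lerD2r.
  apply: (le_trans Ehi); rewrite ler_expR lerNl opprD opprK lerBlDr.
  exact: le_trans Jhi Sdiff.
rewrite EE; congr EFin.
have cM : (fun n => M / n.+1%:R) @ \oo --> (0 : R).
  by rewrite -[X in _ --> X](mulr0 M); apply: cvgMr; exact: cvg_harmonic.
apply/eqP; rewrite eq_le; apply/andP; split.
  have c : (fun n => expR (- J + M / n.+1%:R)) @ \oo --> expR (- J).
    apply: continuous_cvg; first exact: continuous_expR.
    by rewrite -[X in _ --> X](addr0 (- J)); apply: cvgD => //; exact: cvg_cst.
  rewrite -(cvg_lim _ c)//; apply: (limr_ge (cvgP _ c)).
  by apply: nearW => n; have /andP[] := key n.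
have c : (fun n => expR (- J - M / n.+1%:R)) @ \oo --> expR (- J).
  apply: continuous_cvg; first exact: continuous_expR.
  by rewrite -[X in _ --> X](subr0 (- J)); apply: cvgB => //; exact: cvg_cst.
rewrite -[leLHS](cvg_lim _ c)//; apply: (limr_le (cvgP _ c)).
by apply: nearW => n; have /andP[] := key n.
Qed.

End PoissonFunctional.

(** * The chord and cluster integrals *)

Section MaternIntegral.
Context {R : realType}.
Local Notation leb := (@lebesgue_measure R).
Variables (t a : R).
Hypotheses (t0 : 0 <= t) (a0 : 0 < a).

(** A trapezoid in [y]: constant [beta_fn a t] for [|y| <= |t - a|], then falling with slope 1 to 0
    at [|y| = t + a]. It is the length of the displacements in [-a, a] that carry a parent at [y]
    into [-t, t]. *)
Definition overlap (y : R) : R :=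
  Num.max 0 (Num.min (beta_fn a t) (t + a - `|y|)).

Lemma beta_abs : beta_fn a t = t + a - `|t - a|.
Proof.
rewrite /beta_fn; case: (leP t a) => h.
  by rewrite ler0_norm ?subr_le0//; lra.
by rewrite gtr0_norm ?subr_gt0//; lra.
Qed.

Lemma lebesgue_overlap (y : R) :
  leb ([set x | `[- t, t]%classic (y + x)] `&` `[- a, a]) = (overlap y)%:E.
Proof.
have -> : [set x | `[- t, t]%classic (y + x)] `&` `[- a, a] =
    `[Num.max (- t - y) (- a), Num.min (t - y) a]%classic.
  apply/seteqP; split => x /=; rewrite !in_itv/= ge_max le_min.
    move=> [/andP[h1 h2] /andP[-> ->]]; rewrite !andbT.
    by apply/andP; split; lra.
  move=> /andP[/andP[h1 ->] /andP[h2 ->]]; split => //.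
  by apply/andP; split; lra.
rewrite lebesgue_measure_itv/= lte_fin /overlap beta_abs -EFinB -(fun_if EFin).
congr EFin.
(* Each maximum, minimum and absolute value is replaced by one of two linear alternatives, which
   leaves every branch to [lra]. *)
have maxE (u v : R) : Num.max u v = u /\ v <= u \/ Num.max u v = v /\ u <= v.
  by have [h|/ltW h] := leP u v; [right|left].
have minE (u v : R) : Num.min u v = u /\ u <= v \/ Num.min u v = v /\ v <= u.
  by have [h|/ltW h] := leP u v; [left|right].
have normE (u : R) : `|u| = u /\ 0 <= u \/ `|u| = - u /\ u <= 0.
  by have [h|h] := leP 0 u; [left; rewrite ger0_norm|right; rewrite ltr0_norm// ltW].
have [[-> h6]|[-> h6]] := normE (t - a); have [[-> h7]|[-> h7]] := normE y;
  have [[-> h1]|[-> h1]] := maxE (- t - y) (- a);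
  have [[-> h2]|[-> h2]] := minE (t - y) a; case: ltP => h3;
  set M := Num.min _ _; have [[-> h4]|[-> h4]] := maxE 0 M;
  have [[e h5]|[e h5]] : M = _ /\ _ \/ M = _ /\ _ := minE _ _; lra.
Qed.

Lemma continuous_overlap : continuous overlap.
Proof.
apply: max_fun_continuous; first exact: cst_continuous.
apply: min_fun_continuous; first exact: cst_continuous.
move=> y; apply: cvgB; first exact: cvg_cst.
exact: norm_continuous.
Qed.

(** Twice the integral over the half-line, cut at the corners [|t - a|] and [t + a] of the
    trapezoid. The lengths [|t - a|] of the plateau and [beta_fn a t] of the slope add up to the
    linear term [t + a]; the exponential along the slope gives the quotient by [k]. *)
Lemma integral_exp_overlap (k : R) : k <= 0 ->
  (\int[leb]_y (1 - expR (k * overlap y))%:E =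
   (if k == 0 then 0 else
   2 * (t + a - `|t - a| * expR (k * beta_fn a t)
     - (expR (k * beta_fn a t) - 1) / k))%:E)%E.
Proof.
move=> k0; have [->|kn0] := eqVneq k 0.
  under eq_integral do rewrite mul0r expR0 subrr.
  by rewrite integral0.
have ov0 y : 0 <= overlap y by rewrite /overlap le_max lexx.
have phi0 u : 0 <= u -> 0 <= 1 - expR (k * u).
  by move=> u0; rewrite subr_ge0 expR_le1 mulr_le0_ge0.
have cont_phi (h : R -> R) : continuous h -> continuous (fun y => 1 - expR (k * h y)).
  move=> ch y; apply: cvgB; first exact: cvg_cst.
  apply: continuous_cvg; first exact: continuous_expR.
  by apply: cvgMr; exact: ch.
have cphi := cont_phi _ continuous_overlap.
rewrite ge0_symfun_integralT//; last 2 first.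
- by move=> y; exact: phi0.
- by move=> y /=; rewrite /overlap normrN.
rewrite EFinM; congr (_ * _)%E.
have b0 : 0 <= beta_fn a t by rewrite /beta_fn mulr_ge0// le_min t0 ltW.
pose c : R := `|t - a|.
have c0 : 0 <= c by exact: normr_ge0.
have cta : c <= t + a by move: b0; rewrite beta_abs subr_ge0.
have mphi (D : set R) : measurable_fun D (fun y => (1 - expR (k * overlap y))%:E).
  by apply: measurable_funTS; apply/measurable_EFinP; exact: continuous_measurable_fun.
have -> : [set x : R | 0 <= x] = `[0, c]%classic `|` (`]c, t + a] `|` `]t + a, +oo[).
  apply/seteqP; split => x /=; rewrite !in_itv/= ?andbT.
    move=> x0; have [xc|xc] := leP x c; first by left; rewrite x0.
    by right; have [h|h] := leP x (t + a); [left|right].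
  case=> [/andP[]//|[/andP[cx _]|tx]]; first exact: ltW (le_lt_trans c0 cx).
  by rewrite (le_trans (le_trans c0 cta))// ltW.
rewrite ge0_integral_setU//=; last 4 first.
- exact: measurableU.
- exact: mphi.
- by move=> y _; rewrite lee_fin phi0.
- apply/disj_setPRL => y /=; rewrite !in_itv/= andbT.
  case=> [/andP[cy _]|ty] /andP[_]; rewrite leNgt; first by rewrite cy.
  by rewrite (le_lt_trans cta ty).
rewrite ge0_integral_setU//=; last 3 first.
- exact: mphi.
- by move=> y _; rewrite lee_fin phi0.
- apply/disj_setPRL => y /=; rewrite !in_itv/= andbT => ty /andP[_].
  by rewrite leNgt ty.
have -> : (\int[leb]_(x in `[0%R, c]) (1 - expR (k * overlap x))%:E =
   (c * (1 - expR (k * beta_fn a t)))%:E)%E.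
  under eq_integral => x.
    rewrite inE/= in_itv/= => /andP[x0 xc].
    rewrite /overlap (min_idPl _) ?(max_idPr _)//; last first.
      by rewrite beta_abs lerD2l lerN2 ger0_norm.
    over.
  rewrite integral_cst//= lebesgue_measure_itv/= lte_fin.
  case: ltP => hc; first by rewrite sube0 -EFinM mulrC.
  have -> : c = 0 by apply/eqP; rewrite eq_le hc.
  by rewrite mul0r mule0.
have -> : (\int[leb]_(x in `](t + a)%R, +oo[) (1 - expR (k * overlap x))%:E = 0)%E.
  under eq_integral => x.
    rewrite inE/= in_itv/= andbT => xta.
    rewrite /overlap (max_idPl _); last first.
      by rewrite ge_min; apply/orP; right; rewrite ger0_norm; lra.
    rewrite mulr0 expR0 subrr; over.
  by rewrite integral0.
rewrite adde0.
have -> : (\int[leb]_(x in `]c, (t + a)%R]) (1 - expR (k * overlap x))%:E =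
   (beta_fn a t - (expR (k * beta_fn a t) - 1) / k)%:E)%E.
  have bE : t + a - c = beta_fn a t by rewrite beta_abs.
  rewrite integral_itv_obnd_cbnd//.
  under eq_integral => x.
    rewrite inE/= in_itv/= => /andP[cx xta].
    have x0 : 0 <= x by exact: le_trans cx.
    rewrite /overlap (min_idPr _) ?(max_idPr _) ?ger0_norm//; last 2 first.
    - lra.
    - by rewrite ?ger0_norm// -bE; lra.
    over.
  (* The slope degenerates to a point when [t = 0], while the fundamental theorem is applied on a
     proper interval. *)
  have [cl|cl] := ltP c (t + a); last first.
    have ce : c = t + a by apply/eqP; rewrite eq_le cta cl.
    rewrite -bE ce subrr mulr0 expR0 subrr mul0r subr0 set_itv1.
    by rewrite integral_set1.
  have dF (x : R) : is_derive x (1 : R) (fun y => y + k^-1 * expR (k * (t + a - y)))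
      (1 - expR (k * (t + a - x))).
    have du : is_derive x (1 : R) (k *: (cst (t + a) - id) : R -> R) (k *: (0 - 1)).
      by apply: is_deriveZ.
    have dE := is_derive1_comp (is_derive_expR _) du.
    have dF : is_derive x (1 : R) (id + k^-1 *: (expR \o (k *: (cst (t + a) - id))) : R -> R)
      (1 + k^-1 *: (expR (k * (t + a - x)) * (k *: (0 - 1)))).
      apply: is_deriveD; apply: is_deriveZ; exact: dE.
    apply: (is_derive_eq dF); rewrite /GRing.scale/=.
    by field.
  have cF (x : R) : (fun y => y + k^-1 * expR (k * (t + a - y))) @ x -->
      x + k^-1 * expR (k * (t + a - x)).
    apply: cvgD; first exact: cvg_id.
    apply: cvgMr; apply: continuous_cvg; first exact: continuous_expR.
    by apply: cvgMr; apply: cvgB; [exact: cvg_cst|exact: cvg_id].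
  rewrite (@continuous_FTC2 _ _ (fun y => y + k^-1 * expR (k * (t + a - y))))//.
  - rewrite subrr mulr0 expR0 -bE -EFinB; congr EFin; lra.
  - apply: continuous_subspaceT; apply: cont_phi => y.
    by apply: cvgB; [exact: cvg_cst|exact: cvg_id].
  - split.
    + by move=> x _; exact: ex_derive.
    + by apply: cvg_at_right_filter; exact: cF.
    + by apply: cvg_at_left_filter; exact: cF.
  - move=> x _; rewrite derive1E; apply: derive_val.
rewrite -EFinD; congr EFin; rewrite beta_abs -/c; lra.
Qed.

End MaternIntegral.

(** * The change of variable between the distance of a chord and its half-length *)

Section CircleSubstitution.
Context {R : realType}.
Local Notation leb := (@lebesgue_measure R).
Variable r : R.
Hypothesis r0 : 0 < r.

(* Num.sqrt is 0 on negative arguments, so half_chord x = 0 when r < `|x|. *)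
Definition half_chord (x : R) : R := Num.sqrt (r ^+ 2 - x ^+ 2).

Lemma continuous_half_chord : continuous half_chord.
Proof.
move=> x; apply: continuous_cvg; first exact: sqrt_continuous.
by apply: cvgB; [exact: cvg_cst|exact: exprn_continuous].
Qed.

Lemma half_chord_gt0 x : `|x| < r -> 0 < half_chord x.
Proof.
by move=> xr; rewrite sqrtr_gt0 subr_gt0 -(real_normK (num_real x)) ltr_sqr ?nnegrE// ltW.
Qed.

(** Distance and half-chord are the legs of a right triangle with hypotenuse [r], hence an
    involution: one function serves as substitution and as its inverse. *)
Lemma half_chordK x : 0 <= x <= r -> half_chord (half_chord x) = x.
Proof.
move=> /andP[x0 xr]; rewrite /half_chord sqr_sqrtr; last first.
  by rewrite subr_ge0 ler_sqr// nnegrE ltW.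
by rewrite subKr sqrtr_sqr ger0_norm.
Qed.

Lemma half_chord0 : half_chord 0 = r.
Proof. by rewrite /half_chord expr0n subr0 sqrtr_sqr gtr0_norm. Qed.

Lemma is_derive_half_chord (x : R) : `|x| < r ->
  is_derive x 1 half_chord (- (x / half_chord x)).
Proof.
move=> xr; have F0 := half_chord_gt0 xr.
have du : is_derive x (1 : R) (cst (r ^+ 2) - id ^+ 2 : R -> R)
    (0 - (2%:R * x ^+ 1) *: 1).
  by apply: is_deriveB; apply: is_deriveX.
have p0 : 0 < (cst (r ^+ 2) - id ^+ 2 : R -> R) x.
  by move: F0; rewrite sqrtr_gt0.
apply: (is_derive_eq (is_derive1_comp (is_derive1_sqrt p0) du)).
rewrite [X in (2 * X)^-1](_ : _ = half_chord x)// /GRing.scale/=.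
by field; rewrite gt_eqF.
Qed.

Lemma half_chord_lt x y : 0 <= x -> x < y -> y <= r ->
  half_chord y < half_chord x.
Proof.
move=> x0 xy yr; have xr := lt_le_trans xy yr.
have y0 : 0 <= y by exact: le_trans (ltW xy).
rewrite ltr_sqrt; first by rewrite ltrD2l ltrN2 ltr_sqr ?nnegrE.
by rewrite subr_gt0 ltr_sqr// nnegrE// ltW.
Qed.

Lemma half_chord_homo x y : 0 <= x -> x <= y -> half_chord y <= half_chord x.
Proof.
move=> x0 xy; apply: ler_wsqrtr; rewrite lerD2l lerN2 ler_sqr ?nnegrE//.
exact: le_trans xy.
Qed.

Lemma cvg_derive_half_chord (x : R) : `|x| < r ->
  half_chord^`() @ x --> - (x / half_chord x).
Proof.
move=> xr.
have : (fun y => - (y / half_chord y)) @ x --> - (x / half_chord x).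
  apply: cvgN; apply: cvgM; first exact: cvg_id.
  apply: cvgV; first by rewrite gt_eqF// half_chord_gt0.
  exact: continuous_half_chord.
apply: cvg_trans; apply: near_eq_cvg.
have : \forall y \near x, `|y| < r.
  by have /cvgr_lt := @norm_continuous _ R x; apply.
apply: filterS => y yr.
by rewrite derive1E; apply/esym/derive_val; exact: is_derive_half_chord.
Qed.

Variable h : R -> R.
Hypotheses (ch : continuous h) (h0 : forall x, 0 <= h x).

Let phi t := h t * t / half_chord t.

(* Restricted to [0, b] because the derivative of half_chord blows up at r. *)
Lemma integral_half_chord_lt (b : R) : 0 < b < r ->
  (\int[leb]_(x in `[half_chord b, r]) (h (half_chord x))%:E =
   \int[leb]_(t in `[0%R, b]) (phi t)%:E)%E.
Proof.
move=> /andP[b0 br].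
have br' x : 0 <= x <= b -> `|x| < r.
  by move=> /andP[x0 xb]; rewrite ger0_norm// (le_lt_trans xb).
have bb : `|b| < r by apply: br'; rewrite lexx ltW.
have bz : `|0 : R| < r by rewrite normr0.
(* This gives the interval the form required for the decreasing substitution [x = half_chord t] with
   [t] in [0, b]. *)
have -> : r = half_chord 0 by rewrite half_chord0.
rewrite (@integration_by_substitution_decreasing _ half_chord (h \o half_chord)); last 7 first.
- exact: ltW.
- move=> x y; rewrite !in_itv/= => /andP[x0 xb] /andP[y0 yb] yx.
  by apply: half_chord_lt => //; exact: le_trans (ltW br).
- move=> x; rewrite in_itv/= => /andP[x0 xb].
  have xr : `|x| < r by apply: br'; rewrite !ltW.
  rewrite /continuous_at derive1E; have -> := @derive_val _ _ _ _ _ _ _ (is_derive_half_chord xr).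
  exact: cvg_derive_half_chord.
- apply: cvgP; apply: cvg_at_right_filter; exact: cvg_derive_half_chord bz.
- apply: cvgP; apply: cvg_at_left_filter; exact: cvg_derive_half_chord bb.
- split.
  + move=> x; rewrite in_itv/= => /andP[x0 xb].
    have xr : `|x| < r by apply: br'; rewrite !ltW.
    exact: (@ex_derive _ _ _ _ _ _ _ (is_derive_half_chord xr)).
  + by apply: cvg_at_right_filter; exact: continuous_half_chord.
  + by apply: cvg_at_left_filter; exact: continuous_half_chord.
- apply: continuous_subspaceT => x.
  by apply: continuous_comp; [exact: continuous_half_chord|exact: ch].
apply: eq_integral => x; rewrite inE/= in_itv/= => /andP[x0 xb].
have xr : `|x| < r by apply: br'; rewrite x0.
congr EFin.
transitivity (h (half_chord (half_chord x)) * - derive1 half_chord x) => //.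
rewrite half_chordK ?x0 ?(le_trans xb (ltW br))// /phi -mulrA derive1E.
congr (_ * _).
by have -> := @derive_val _ _ _ _ _ _ _ (is_derive_half_chord xr); rewrite opprK.
Qed.

(** The limit [b] to [r] by monotone convergence on both sides. The unions of the growing intervals
    miss only [t = r] and [x = 0], which are null. *)
Lemma integral_half_chord :
  (\int[leb]_(x in `[0%R, r]) (h (half_chord x))%:E =
   \int[leb]_(t in `[0%R, r]) (phi t)%:E)%E.
Proof.
(* [n.+2] rather than [n.+1] makes [b 0] positive. *)
pose b n : R := r - r / n.+2%:R.
have b01 n : 0 < b n < r.
  rewrite subr_gt0 ltrBlDr ltrDl divr_gt0 ?ltr0n// andbT.
  by rewrite ltr_pdivrMr ?ltr0n// ltr_pMr// ltr1n.
have b_nd n m : (n <= m)%N -> b n <= b m.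
  move=> nm; rewrite lerD2l lerN2 ler_pM2l// lef_pV2 ?posrE ?ltr0n//.
  by rewrite ler_nat !ltnS.
have b_lim y : y < r -> exists n, y <= b n.
  move=> yr; have ry : 0 < r - y by rewrite subr_gt0.
  exists (Num.truncn (r / (r - y))).
  rewrite /b lerBrDr -lerBrDl ler_pdivrMr ?ltr0n// mulrC -ler_pdivrMr//.
  have /andP[_ /ltW h1] := truncn_itv (divr_ge0 (ltW r0) (ltW ry)).
  by rewrite (le_trans h1)// ler_nat.
have mphi n : measurable_fun `[0, b n] (fun t => (phi t)%:E).
  apply/measurable_EFinP; apply: subspace_continuous_measurable_fun => //.
  apply/subspace_continuousP => x /=; rewrite in_itv/= => /andP[x0 xb].
  have /andP[_ bnr] := b01 n.
  have xr : `|x| < r by rewrite ger0_norm// (le_lt_trans xb).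
  apply: cvg_within_filter; apply: cvgM.
    by apply: cvgM; [exact: ch|exact: cvg_id].
  apply: cvgV; first by rewrite gt_eqF// half_chord_gt0.
  exact: continuous_half_chord.
have chF : continuous (h \o half_chord).
  by move=> x; apply: continuous_comp; [exact: continuous_half_chord|exact: ch].
have mhF (D : set R) : measurable_fun D (fun x => (h (half_chord x))%:E).
  by apply: measurable_funTS; apply/measurable_EFinP; exact: continuous_measurable_fun.
have cR : (\int[leb]_(t in `[0%R, b n]) (phi t)%:E)%E @[n --> \oo] -->
    (\int[leb]_(t in `[0%R, r]) (phi t)%:E)%E.
  have -> : (\int[leb]_(t in `[0%R, r]) (phi t)%:E =
      \int[leb]_(t in \bigcup_n `[0%R, b n]) (phi t)%:E)%E.
    have bE : \bigcup_n `[0, b n]%classic = `[0, r[%classic.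
      apply/seteqP; split => x /=.
        move=> [n _ /=]; rewrite !in_itv/= => /andP[-> xb] /=.
        by have /andP[_] := b01 n; exact: le_lt_trans.
      rewrite in_itv/= => /andP[x0 xr]; have [n xn] := b_lim _ xr.
      by exists n => //=; rewrite in_itv/= x0.
    rewrite bE integral_itv_bndo_bndc// -bE.
    by apply/measurable_fun_bigcup => //.
  apply: ge0_nondecreasing_set_cvg_integral => //.
  - move=> n m nm; apply/subsetPset => x /=; rewrite !in_itv/= => /andP[-> xb] /=.
    exact: le_trans (b_nd _ _ nm).
  - move=> n x /=; rewrite in_itv/= => /andP[x0 _].
    by rewrite lee_fin divr_ge0 ?sqrtr_ge0// mulr_ge0.
have cL : (\int[leb]_(x in `[half_chord (b n), r]) (h (half_chord x))%:E)%E @[n --> \oo] -->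
    (\int[leb]_(x in `[0%R, r]) (h (half_chord x))%:E)%E.
  have -> : (\int[leb]_(x in `[0%R, r]) (h (half_chord x))%:E =
      \int[leb]_(x in \bigcup_n `[half_chord (b n), r]) (h (half_chord x))%:E)%E.
    have -> : \bigcup_n `[half_chord (b n), r]%classic = `]0, r]%classic.
      apply/seteqP; split => x /=.
        move=> [n _ /=]; rewrite !in_itv/= => /andP[bx ->]; rewrite andbT.
        apply: lt_le_trans bx; apply: half_chord_gt0.
        by have /andP[bn0 bnr] := b01 n; rewrite gtr0_norm.
      rewrite in_itv/= => /andP[x0 xr].
      have Fxr : half_chord x < r.
        by rewrite -[ltRHS]half_chord0; exact: half_chord_lt.
      have [n xn] := b_lim _ Fxr; have /andP[bn0 bnr] := b01 n.
      exists n => //=; rewrite in_itv/= xr andbT.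
      rewrite -[leRHS](half_chordK (x := x)); last by rewrite xr ltW.
      by apply: half_chord_homo; rewrite ?sqrtr_ge0.
    by rewrite integral_itv_obnd_cbnd.
  apply: ge0_nondecreasing_set_cvg_integral => //.
  - move=> n m nm; apply/subsetPset => x /=; rewrite !in_itv/= => /andP[bx ->].
    rewrite andbT; apply: le_trans bx.
    by apply: half_chord_homo (b_nd _ _ nm); have /andP[/ltW] := b01 n.
  - by move=> n; exact: mhF.
  - by move=> n x _; rewrite lee_fin.
have LR : (fun n => \int[leb]_(x in `[half_chord (b n), r]) (h (half_chord x))%:E)%E =
    (fun n => \int[leb]_(t in `[0%R, b n]) (phi t)%:E)%E.
  by apply/funext => n; exact: integral_half_chord_lt.
by rewrite LR in cL; exact: (cvg_unique _ cL cR).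
Qed.

End CircleSubstitution.

(** * The exponent g and the integral over the lines *)

Section GFunction.
Context {R : realType}.
Local Notation leb := (@lebesgue_measure R).
Variables (m lamP a s : R).
Hypotheses (m0 : 0 < m) (lamP0 : 0 < lamP) (a0 : 0 < a) (s01 : 0 <= s <= 1).

Local Notation g := (g_fn m lamP a s).
Local Notation lamd := (m / (2 * a)).

Lemma lamd_gt0 : 0 < lamd.
Proof. by rewrite divr_gt0// mulr_gt0. Qed.

(** The origin of [g]: the exponential under the integral is the generating function of the
    daughters in [-t, t] of a parent at [y], so [- g t] is the exponent of the Poisson functional of
    the parents on one line. *)
Lemma g_fnE (t : R) : 0 <= t ->
  (lamP%:E * \int[leb]_y (1 - expR (lamd * (s - 1) * overlap t a y))%:E =
   (- g t)%:E)%E.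
Proof.
move=> t0; have lamd0 := lamd_gt0.
rewrite integral_exp_overlap//; last first.
  by rewrite mulr_ge0_le0 ?(ltW lamd0)// subr_le0; case/andP: s01.
rewrite /g_fn mulf_eq0 (gt_eqF lamd0) subr_eq0/=.
case: ifP => [_|/negbT s1]; first by rewrite mule0 oppr0.
rewrite -EFinM; congr EFin.
rewrite [lamd * beta_fn a t * (s - 1)]mulrAC.
lra.
Qed.

(** Read off the integral of a nonnegative function rather than the closed form. It places
    [expR (g t)] in [0, 1], as the functional of the lines requires. *)
Lemma g_fn_le0 (t : R) : 0 <= t -> g t <= 0.
Proof.
move=> t0; rewrite -oppr_ge0 -lee_fin -g_fnE//.
apply: mule_ge0; first by rewrite lee_fin ltW.
apply: integral_ge0 => y _; rewrite lee_fin subr_ge0 expR_le1.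
rewrite mulr_le0_ge0//; last by rewrite /overlap le_max lexx.
by rewrite mulr_ge0_le0 ?(ltW lamd_gt0)// subr_le0; case/andP: s01.
Qed.

(** A line that misses the disk has [half_chord] 0; this value gives it the factor 1. *)
Lemma g_fn0 : g 0 = 0.
Proof.
rewrite /g_fn; case: ifP => // _.
rewrite /beta_fn (min_idPl (ltW a0)) !(mulr0, mul0r) expR0 subrr mul0r.
by rewrite sub0r normrN gtr0_norm//; lra.
Qed.

Lemma continuous_g_fn : continuous g.
Proof.
have [s1|s1] := eqVneq s 1.
  rewrite (_ : g_fn _ _ _ _ = cst 0); first exact: cst_continuous.
  by apply/funext => t; rewrite /g_fn s1 eqxx.
have cb : continuous (beta_fn a).
  move=> t; apply: cvgMr.
  by apply: (@min_fun_continuous _ R R id (cst a)); [move=> ?; exact: cvg_id|exact: cst_continuous].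
have ce : continuous (fun t => expR (lamd * beta_fn a t * (s - 1))).
  move=> t; apply: continuous_cvg; first exact: continuous_expR.
  by apply: cvgMl; apply: cvgMr; exact: cb.
rewrite /g_fn (negbTE s1) => t; apply: cvgMr; apply: cvgD; first apply: cvgB.
- apply: cvgM; last exact: ce.
  by apply: cvg_norm; apply: cvgB; [exact: cvg_id|exact: cvg_cst].
- by apply: cvgD; [exact: cvg_id|exact: cvg_cst].
- by apply: cvgMl; apply: cvgB; [exact: ce|exact: cvg_cst].
Qed.

Variable r : R.
Hypothesis r0 : 0 < r.

(** The integrand is even in the signed distance, which gives the factor 2, and vanishes beyond [r].
    On [0, r] the constant 1 integrates to [r], and the rest is the substitution. *)
Lemma integral_lines :
  (\int[leb]_x (1 - expR (g (half_chord r x)))%:E =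
   2%:E * (r - fine (\int[leb]_(t in `[0%R, r])
       (expR (g t) * t / Num.sqrt (r ^+ 2 - t ^+ 2))%:E))%:E)%E.
Proof.
have ch : continuous (fun t => expR (g t)).
  by move=> t; apply: continuous_cvg; [exact: continuous_expR|exact: continuous_g_fn].
have cf : continuous (fun x => expR (g (half_chord r x))).
  move=> x; apply: (@continuous_comp _ _ _ (half_chord r) (fun t => expR (g t))).
    exact: continuous_half_chord.
  exact: ch.
have f1 x : expR (g (half_chord r x)) <= 1 by rewrite expR_le1 g_fn_le0// sqrtr_ge0.
have cf1 : continuous (fun x => 1 - expR (g (half_chord r x))).
  by move=> x; apply: cvgB; [exact: cvg_cst|exact: cf].
have mf (D : set R) : measurable_fun D (fun x => (expR (g (half_chord r x)))%:E).
  by apply: measurable_funTS; apply/measurable_EFinP; exact: continuous_measurable_fun.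
have mf1 (D : set R) : measurable_fun D (fun x => (1 - expR (g (half_chord r x)))%:E).
  by apply: measurable_funTS; apply/measurable_EFinP; exact: continuous_measurable_fun.
have even : (fun x => 1 - expR (g (half_chord r x))) =1
    (fun x => 1 - expR (g (half_chord r x))) \o -%R.
  by move=> x /=; congr (1 - expR (g _)); rewrite /half_chord sqrrN.
have f10 x : 0 <= 1 - expR (g (half_chord r x)) by rewrite subr_ge0.
rewrite (ge0_symfun_integralT f10 cf1 even); congr (_ * _)%E.
have -> : [set x : R | 0 <= x] = `[0, r]%classic `|` `]r, +oo[.
  apply/seteqP; split => x /=; rewrite !in_itv/= ?andbT.
    by move=> x0; have [xr|xr] := leP x r; [left; rewrite x0|right].
  by case=> [/andP[]//|rx]; exact: le_trans (ltW r0) (ltW rx).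
rewrite ge0_integral_setU//=; last 3 first.
- exact: mf1.
- by move=> y _; rewrite lee_fin subr_ge0.
- apply/disj_setPRL => y /=; rewrite !in_itv/= andbT => ry /andP[_].
  by rewrite leNgt ry.
have -> : (\int[leb]_(x in `]r, +oo[) (1 - expR (g (half_chord r x)))%:E = 0)%E.
  under eq_integral => x.
    rewrite inE/= in_itv/= andbT => rx.
    rewrite /half_chord ler0_sqrtr; last first.
      by rewrite subr_le0 ler_sqr ?nnegrE ltW// (lt_trans r0).
    rewrite g_fn0 expR0 subrr; over.
  by rewrite integral0.
rewrite adde0 -[X in fine X](integral_half_chord r0 ch); last first.
  by move=> t; exact: expR_ge0.
have intr : (\int[leb]_(x in `[0%R, r]) (cst 1%E x) = r%:E)%E.
  by rewrite integral_cst//= mul1e lebesgue_measure_itv/= lte_fin r0 sube0.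
have I0 : (0 <= \int[leb]_(x in `[0%R, r]) (expR (g (half_chord r x)))%:E)%E.
  by apply: integral_ge0 => x _; rewrite lee_fin expR_ge0.
(* The bound by [r] makes [fine] faithful and permits the subtraction. *)
have Ifin : (\int[leb]_(x in `[0%R, r]) (expR (g (half_chord r x)))%:E \is a fin_num)%E.
  rewrite ge0_fin_numE// (@le_lt_trans _ _ r%:E) ?ltry// -intr.
  apply: ge0_le_integral => //.
  - exact: mf.
  - by move=> x _; rewrite lee_fin.
apply/eqP; rewrite EFinB fineK// eq_sym sube_eq//; last first.
  by rewrite fin_num_adde_defl.
rewrite -intr -ge0_integralD//; last 3 first.
- by move=> x _; rewrite lee_fin subr_ge0.
- exact: mf1.
- exact: mf.
by apply/eqP; apply: eq_integral => x _; rewrite -EFinD subrK.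
Qed.

End GFunction.

(** * Matern cluster processes *)

Section PointProcessFacts.
Context {R : realType} {d : measure_display} {T : measurableType d}.

Lemma pp_events_measurable dX (X : measurableType dX) (P : probability T R)
    (pres : nat -> T -> bool) (pos : nat -> T -> X) Lam :
  pp_is_PPP P pres pos Lam -> forall A, pp_events pres pos A -> measurable A.
Proof.
move=> [mpres [mpos _]] A [[i ->]|[i [B [mB ->]]]]; first exact: mpres.
by rewrite -[X in measurable X]setTI; exact: mpos.
Qed.

(** Measurability is for a generated sigma-algebra, not that of [T]: decoupling integrates functions
    measurable for the product of two generated ones. *)
Lemma measurable_pres dX (X : measurableType dX) (pres : nat -> T -> bool)
    (pos : nat -> T -> X) (H : set (set T)) i : pp_events pres pos `<=` H ->
  measurable_fun setT (pres i : g_sigma_algebraType H -> bool).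
Proof.
move=> sub; apply: (@measurable_fun_bool _ _ _ _ true); rewrite setTI.
by apply: sub_sigma_algebra; apply: sub; left; exists i.
Qed.

Lemma measurable_pos dX (X : measurableType dX) (pres : nat -> T -> bool)
    (pos : nat -> T -> X) (H : set (set T)) i : pp_events pres pos `<=` H ->
  measurable_fun setT (pos i : g_sigma_algebraType H -> X).
Proof.
move=> sub _ B mB; rewrite setTI; apply: sub_sigma_algebra; apply: sub.
by right; exists i, B.
Qed.

Variables (s : R).
Hypothesis s01 : 0 <= s <= 1.

Lemma if_01 (b : bool) : 0 <= (if b then s else 1) <= 1.
Proof. by case: b => //; rewrite ler01 lexx. Qed.

Lemma pgf_pow_bool (b : bool) : pgf_pow s b%:R%:E = if b then s else 1.
Proof. by case: b => /=; rewrite ?powRr0// powRr1//; case/andP: s01. Qed.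

(** The case of one cell; the step lemma takes a sequence of disjoint cells, so the others are set
    to be empty. *)
Lemma integral_pgf_count dX (X : measurableType dX) (P : probability T R)
    (pres : nat -> T -> bool) (pos : nat -> T -> X)
    (mu : {measure set X -> \bar R}) (B : set X) :
  pp_is_PPP P pres pos mu -> measurable B -> (mu B < +oo)%E ->
  (\int[P]_w (iprod (fun k => if pres k w && `[< B (pos k w) >] then s else 1))%:E =
   (expR (fine (mu B) * (s - 1)))%:E)%E.
Proof.
move=> ppp mB finB; have [mpres [mpos _]] := ppp.
pose B' l := if l == 0%N then B else set0.
have := @integral_ppprod_step _ _ _ _ _ P pres pos mpres mpos mu ppp 1 B' (fun=> s).
rewrite big_ord1 => <- //.
- apply: eq_integral => w _; congr (iprod _)%:E; apply/funext => k.
  by case: (pres k w) => //=; rewrite big_ord1.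
- by case=> [|l]; rewrite /B'/=.
- by case => [|l]; rewrite /B'/= ?measure0.
- by case=> [|l] [|l'] //= _; rewrite ?setI0 ?set0I.
Qed.

End PointProcessFacts.

Section MaternClusterProcess.
Context {R : realType} {d : measure_display} {T : measurableType d}.
Variables (P : probability T R) (m lamP a s : R).
Hypotheses (m0 : 0 < m) (lamP0 : 0 < lamP) (a0 : 0 < a) (s01 : 0 <= s <= 1).
Variables (I : eqType) (G : I -> set (set T)).
Hypothesis mG : forall i A, G i A -> measurable A.
Hypothesis indG : mutually_independent P G.
Variables (iP : I) (iD : nat -> I).
Hypotheses (iD_inj : injective iD) (iDP : forall j, iD j != iP).
Variables (presP : nat -> T -> bool) (posP : nat -> T -> R).
Variables (presD : nat -> nat -> T -> bool) (posD : nat -> nat -> T -> R).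
Hypotheses (GP : G iP = pp_events presP posP)
  (GD : forall j, G (iD j) = pp_events (presD j) (posD j)).
Local Notation leb := (@lebesgue_measure R).
Local Notation lamd := (m / (2 * a)).
Hypothesis pppP : pp_is_PPP P presP posP (fun B => lamP%:E * leb B)%E.
Hypothesis pppD : forall j, pp_is_PPP P (presD j) (posD j)
  (fun B => lamd%:E * leb (B `&` `[(- a)%R, a]))%E.

Lemma measurable_factor dZ (Z : measurableType dZ) (p q : Z -> bool)
    (x y : Z -> R) (A : set R) : measurable_fun setT p -> measurable_fun setT q ->
  measurable_fun setT x -> measurable_fun setT y -> measurable A ->
  measurable_fun setT (fun z => if p z && q z && `[< A (x z + y z) >] then s else 1).
Proof.
move=> mp mq mx my mA; apply: measurable_fun_ifT => //.
apply: measurable_and; first exact: measurable_and.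
apply: (@measurable_fun_bool _ _ _ _ true); rewrite setTI.
rewrite (_ : _ @^-1` _ = (fun z => x z + y z) @^-1` A); last first.
  by apply/seteqP; split => z /= /asboolP.
by rewrite -[X in measurable X]setTI; apply: measurable_funD.
Qed.

(** Parents live on the first sample point and daughters, as displacements centred at 0, on the
    second. With the parents frozen, a present parent at [y] has mean factor [q y], and the parents
    then see the product of [q] over their points. *)
Lemma mcp_pgf (t : R) : 0 <= t ->
  (\int[P]_w (iprod (fun j => iprod (fun k =>
      if presP j w && presD j k w && `[< `[- t, t]%classic (posP j w + posD j k w) >]
      then s else 1)))%:E = (expR (g_fn m lamP a s t))%:E)%E.
Proof.
move=> t0; set A : set R := `[- t, t]%classic.
have mA : measurable A by exact: measurable_itv.
pose GA := \bigcup_(k in [set iP]) G k.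
pose KD : set I := range iD.
pose GB := \bigcup_(k in KD) G k.
have mGA := measurable_bigcup_families mG (K := [set iP]).
have mGB := measurable_bigcup_families mG (K := KD).
have subA : pp_events presP posP `<=` GA by move=> B; rewrite -GP => h; exists iP.
have subB j : pp_events (presD j) (posD j) `<=` GB.
  by move=> B; rewrite -GD => h; exists (iD j) => //; exists j.
have dAB : [set iP] `&` KD = set0.
  apply/seteqP; split => // i /= [-> [j _ /eqP]].
  by rewrite (negbTE (iDP j)).
have ind := disjoint_indep_families mG indG dAB.
pose H j (z : T * T) := iprod (fun k =>
  if presP j z.1 && presD j k z.2 && `[< A (posP j z.1 + posD j k z.2) >] then s else 1).
have H01 j z : 0 <= H j z <= 1 by apply: iprod_01 => k; exact: if_01.
pose F (z : g_sigma_algebraType GA * g_sigma_algebraType GB) : \bar R :=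
  (iprod (fun j => H j z))%:E.
have mF : measurable_fun setT F.
  apply/measurable_EFinP; apply: measurable_iprod => [j|j z]; last exact: H01.
  apply: measurable_iprod => [k|k z]; last exact: if_01.
  apply: measurable_factor => //.
  - exact: (measurableT_comp (measurable_pres j subA)).
  - exact: (measurableT_comp (measurable_pres k (@subB j))).
  - exact: (measurableT_comp (measurable_pos j subA)).
  - exact: (measurableT_comp (measurable_pos k (@subB j))).
have F0 z : (0 <= F z)%E by rewrite lee_fin; have /andP[] := iprod_01 (H01 ^~ z).
have /= -> := decoupling mGA mGB ind F0 mF.
pose q y := expR (lamd * (s - 1) * overlap t a y).
have lamd0 : 0 < lamd by exact: lamd_gt0.
have q01 y : 0 <= q y <= 1.
  rewrite expR_ge0 expR_le1 mulr_le0_ge0//; last by rewrite /overlap le_max lexx.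
  by rewrite mulr_ge0_le0 ?(ltW lamd0)// subr_le0; case/andP: s01.
have mDa : measurable (`[- a, a]%classic : set R) by exact: measurable_itv.
(* The intensity, a plain function in the hypotheses, is repackaged as a measure for the Poisson
   functional; the two agree by computation. *)
pose nu : {measure set (measurableTypeR R) -> \bar R} :=
  mscale (NngNum (ltW lamd0)) (mrestr leb mDa).
have nuE j : @pp_is_PPP R d T _ (measurableTypeR R) P (presD j) (posD j) nu by exact: pppD.
have EH j w : (\int[P]_w' (H j (w, w'))%:E =
    (if presP j w then q (posP j w) else 1)%:E)%E.
  rewrite /H/=; case: (presP j w) => /=; last first.
    under eq_integral do rewrite iprod1.
    by rewrite integral_cst// mul1e; exact: probability_setT.
  have mB : measurable [set x | A (posP j w + x)].
    rewrite -[X in measurable X]setTI.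
    by apply: (measurable_funD (f := cst (posP j w)) (g := id)).
  have := integral_pgf_count s01 (nuE j) mB.
  have -> : nu [set x | A (posP j w + x)] = (lamd * overlap t a (posP j w))%:E.
    by rewrite /nu/= /mscale/= /mrestr lebesgue_overlap.
  rewrite ltry => -> //=; congr (expR _)%:E; ring.
transitivity (\int[P]_w (ppprod presP posP q w)%:E)%E.
  apply: eq_integral => w _.
  apply: (@integral_iprod_blocks _ _ _ P I G mG indG (fun j => [set iD j])
    (fun j w' => H j (w, w'))) => //.
  - move=> i j ij; apply/seteqP; split => // k /= [-> /iD_inj e].
    by rewrite e eqxx in ij.
  - move=> j.
    have subj : pp_events (presD j) (posD j) `<=` \bigcup_(k in [set iD j]) G k.
      by move=> B; rewrite -GD => h; exists (iD j).
    apply: measurable_iprod => [k|k w']; last exact: if_01.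
    apply: (measurable_factor (p := cst (presP j w)) (x := cst (posP j w))) => //.
    + exact: (measurable_pres k subj).
    + exact: (measurable_pos k subj).
have [mpres [mpos _]] := pppP.
pose mu : {measure set (measurableTypeR R) -> \bar R} := mscale (NngNum (ltW lamP0)) leb.
have muE : @pp_is_PPP R d T _ (measurableTypeR R) P presP posP mu by exact: pppP.
have cq : continuous q.
  move=> y; apply: continuous_cvg; first exact: continuous_expR.
  by apply: cvgMr; exact: continuous_overlap.
have mq : measurable_fun setT q by exact: continuous_measurable_fun.
(* A parent farther than [t + a] from the origin has no daughter in [-t, t], so [q] is 1 off this
   interval. *)
rewrite (@integral_ppprod _ _ _ _ (measurableTypeR R) _ _ _ mpres mpos _ muE q
  `[- (t + a), t + a]%classic) //.
- rewrite /mu ge0_integral_mscale//.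
  + by rewrite /q /= g_fnE//= opprK.
  + by apply/measurable_EFinP; exact: measurable_funB.
  + by move=> y _; rewrite lee_fin subr_ge0; have /andP[] := q01 y.
- rewrite /mu/= /mscale/= lebesgue_measure_itv/= lte_fin; case: ifP => _.
    by rewrite -EFinB -EFinM ltry.
  by rewrite mule0 ltry.
- move=> y; rewrite /= in_itv/= => /negP; rewrite negb_and -!ltNge => yta.
  rewrite /q /overlap (max_idPl _) ?mulr0 ?expR0//.
  rewrite ge_min; apply/orP; right; rewrite subr_le0.
  case/orP: yta => h; last by rewrite (le_trans (ltW h))// ler_norm.
  by rewrite -normrN (le_trans _ (ler_norm _))// lerNr ltW.
Qed.

End MaternClusterProcess.

(** * Disk counts of the line process *)

(** Pythagoras in the orthonormal frame of the line: [rho] is the coordinate along its normal and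
    [x] the one along its direction, so the angle cancels. *)
Lemma disk_line_param (R : realType) (r : R) (rp : R * R) (x : R) :
  disk r (line_param rp x) = (rp.1 ^+ 2 + x ^+ 2 <= r ^+ 2) :> Prop.
Proof.
rewrite /disk /line_param/=; congr (is_true (_ <= _)).
rewrite -[RHS]mulr1 -(cos2Dsin2 rp.2); ring.
Qed.

(* measurableTypeR R is the carrier of lebesgue_measure; its display differs from
   the one of R, although the measurable sets are the same. *)
Lemma PPP_rho (R : realType) (d : measure_display) (T : measurableType d)
    (P : probability T R) (lamL : R) (lamL0 : 0 <= lamL * pi)
    (presL : nat -> T -> bool) (posL : nat -> T -> (R * R)%type) :
  pp_is_PPP P presL posL
    (fun B => (lamL%:E *
       (lebesgue_measure \x lebesgue_measure)
         (B `&` (setT `*` `[0%R, pi%R[)))%E) ->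
  @pp_is_PPP R d T _ (measurableTypeR R) P presL (fun i w => (posL i w).1)
    (mscale (NngNum lamL0) lebesgue_measure).
Proof.
move=> [mpres [mpos law]]; split => //; split.
  by move=> i; exact: measurableT_comp (mpos i).
move=> n B k mB finB disjB.
(* Counts of the distances are counts of strips [B l * R]; the admissible angles fill [0, pi), which
   is where the factor [pi] arises. *)
have LamE l : (lamL%:E * (lebesgue_measure \x lebesgue_measure)
    ((B l `*` setT) `&` (setT `*` `[0%R, pi%R[)) =
    mscale (NngNum lamL0) lebesgue_measure (B l))%E.
  rewrite -setXI setIT setTI product_measure1E//.
  rewrite [X in (_ * (_ * X))%E](_ : _ = (pi : R)%:E); last first.
    by rewrite [LHS]lebesgue_measure_itv/= lte_fin pi_gt0 sube0.
  by rewrite /mscale/= EFinM muleAC muleA.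
have := law n (fun l => B l `*` setT) k.
have -> : (fun l => [set w | pp_count presL posL w (B l `*` setT) = ((k l)%:R : R)%:E]) =
  (fun l => [set w | pp_count presL (fun i w0 => (posL i w0).1) w (B l) = ((k l)%:R : R)%:E]).
  apply/funext => l; apply/funext => w; rewrite /=/mkset; congr (_ = _).
  rewrite /pp_count; apply: eq_eseriesr => i _; congr (_%:R%:E).
  congr (_ && `[< _ >]); apply/propext; split => [[]//|]; by split.
move=> ->.
- by apply: eq_bigr => l _; rewrite LamE.
- by move=> l; apply: measurableX; [exact: mB|exact: measurableT].
- by move=> l; rewrite LamE; exact: finB.
- move=> l l' ll'; rewrite -setXI disjB// set0X//.
Qed.

Theorem theorem3 (R : realType) (d : measure_display) (T : measurableType d)
  (P : probability T R) (lamL m lamP a r : R)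
  (* Poisson line process: line i is present iff presL i, with (rho, phi) = posL i *)
  (presL : nat -> T -> bool) (posL : nat -> T -> (R * R)%type)
  (* parent process of the MCP attached to line i *)
  (presP : nat -> nat -> T -> bool) (posP : nat -> nat -> T -> R)
  (* daughter process (centred at 0) of parent j of the MCP attached to line i *)
  (presD : nat -> nat -> nat -> T -> bool) (posD : nat -> nat -> nat -> T -> R) :
  0 < lamL -> 0 < m -> 0 < lamP -> 0 < a -> 0 < r ->
  pp_is_PPP P presL posL
    (fun B => (lamL%:E *
       (lebesgue_measure \x lebesgue_measure)
         (B `&` (setT `*` `[0%R, pi%R[)))%E) ->
  (forall i, pp_is_PPP P (presP i) (posP i)
    (fun B => (lamP%:E * lebesgue_measure B)%E)) ->
  (forall i j, pp_is_PPP P (presD i j) (posD i j)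
    (fun B => ((m / (2 * a))%:E * lebesgue_measure (B `&` `[(- a)%R, a]))%E)) ->
  mutually_independent P
    (fun k : (unit + (nat + nat * nat))%type =>
       match k with
       | inl _ => pp_events presL posL
       | inr (inl i) => pp_events (presP i) (posP i)
       | inr (inr ij) => pp_events (presD ij.1 ij.2) (posD ij.1 ij.2)
       end) ->
  let S : T -> \bar R := fun w =>
    (\sum_(i <oo) \sum_(j <oo) \sum_(k <oo)
       ((presL i w && presP i j w && presD i j k w &&
         `[< disk r (line_param (posL i w) (posP i j w + posD i j k w)) >])%:R)%:E)%E in
  forall s : R, 0 <= s <= 1 ->
    (\int[P]_w (pgf_pow s (S w))%:E)%E =
    (expR (- (2 * pi * lamL *
       (r - fine (\int[lebesgue_measure]_(t in `[0%R, r])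
                    (expR (g_fn m lamP a s t) * t / Num.sqrt (r ^+ 2 - t ^+ 2))%R%:E)%E))))%:E.
Proof.
move=> lamL0 m0 lamP0 a0 r0 pppL pppP pppD indG S s s01.
pose I : eqType := (unit + (nat + nat * nat))%type.
set G := (X in mutually_independent P X) in indG.
have mG (k : I) A : G k A -> measurable A.
  case: k => [u|[i|ij]] /=.
  - exact: (pp_events_measurable pppL).
  - exact: (pp_events_measurable (pppP i)).
  - exact: (pp_events_measurable (pppD ij.1 ij.2)).
pose iL : I := inl tt; pose iP i : I := inr (inl i).
pose iD i j : I := inr (inr (i, j)).
pose KL : set I := [set iL]; pose KR : set I := ~` [set iL].
have dLR : KL `&` KR = set0 by rewrite setICr.
have ind := disjoint_indep_families mG indG dLR.
pose GL := \bigcup_(k in KL) G k; pose GR := \bigcup_(k in KR) G k.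
have mGL := measurable_bigcup_families mG (K := KL).
have mGR := measurable_bigcup_families mG (K := KR).
have subL : pp_events presL posL `<=` GL by move=> B h; exists iL.
have subP i : pp_events (presP i) (posP i) `<=` GR by move=> B h; exists (iP i).
have subD i j : pp_events (presD i j) (posD i j) `<=` GR by move=> B h; exists (iD i j).
(* Lines are read from [z.1], parents and daughters from [z.2]; on the diagonal this is the
   indicator summed in [S]. *)
pose b i j k (z : T * T) : bool := presL i z.1 && presP i j z.2 && presD i j k z.2 &&
  ((posL i z.1).1 ^+ 2 + (posP i j z.2 + posD i j k z.2) ^+ 2 <= r ^+ 2).
pose H i z := iprod (fun j => iprod (fun k => if b i j k z then s else 1)).
have H01 i z : 0 <= H i z <= 1.
  by apply: iprod_01 => j; apply: iprod_01 => k; exact: if_01.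
pose F (z : g_sigma_algebraType GL * g_sigma_algebraType GR) : \bar R :=
  (iprod (fun i => H i z))%:E.
have SF w : (pgf_pow s (S w))%:E = F (w, w).
  congr EFin; rewrite /S pgf_pow_series//; last first.
    by move=> i; apply: nneseries_ge0 => j _ _; apply: nneseries_ge0 => k _ _.
  congr iprod; apply/funext => i; rewrite pgf_pow_series//; last first.
    by move=> j; apply: nneseries_ge0 => k _ _.
  congr iprod; apply/funext => j; rewrite pgf_pow_series//.
  congr iprod; apply/funext => k; rewrite disk_line_param pgf_pow_bool//.
  by rewrite /b /= asboolb.
under eq_integral do rewrite SF.
have mb dZ (Z : measurableType dZ) (p1 p2 p3 : Z -> bool) (x y z : Z -> R) :
    measurable_fun setT p1 -> measurable_fun setT p2 -> measurable_fun setT p3 ->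
    measurable_fun setT x -> measurable_fun setT y -> measurable_fun setT z ->
    measurable_fun setT (fun u => if p1 u && p2 u && p3 u &&
       (x u ^+ 2 + (y u + z u) ^+ 2 <= r ^+ 2) then s else 1).
  move=> m1 m2 m3 mx my mz; apply: measurable_fun_ifT => //.
  apply: measurable_and; first by do 2?apply: measurable_and.
  apply: measurable_fun_ler => //; apply: measurable_funD.
    exact: measurable_funX.
  by apply: measurable_funX; exact: measurable_funD.
have mF : measurable_fun setT F.
  apply/measurable_EFinP; apply: measurable_iprod => [i|i z]; last exact: H01.
  apply: measurable_iprod => [j|j z]; last by apply: iprod_01 => k; exact: if_01.
  apply: measurable_iprod => [k|k z]; last exact: if_01.
  apply: mb.
  - exact: (measurableT_comp (measurable_pres i subL)).
  - exact: (measurableT_comp (measurable_pres j (@subP i))).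
  - exact: (measurableT_comp (measurable_pres k (@subD i j))).
  - apply: (measurableT_comp (f := fst)) => //.
    exact: (measurableT_comp (measurable_pos i subL)).
  - exact: (measurableT_comp (measurable_pos j (@subP i))).
  - exact: (measurableT_comp (measurable_pos k (@subD i j))).
have F0 z : (0 <= F z)%E by rewrite lee_fin; have /andP[] := iprod_01 (H01 ^~ z).
have /= -> := decoupling mGL mGR ind F0 mF.
pose f x := expR (g_fn m lamP a s (half_chord r x)).
have f01 x : 0 <= f x <= 1.
  by rewrite expR_ge0 expR_le1 g_fn_le0// sqrtr_ge0.
have EH i w : (\int[P]_w' (H i (w, w'))%:E =
    (if presL i w then f (posL i w).1 else 1)%:E)%E.
  rewrite /H /b /=; case: (presL i w) => /=; last first.
    under eq_integral.
      move=> w' _; under [X in iprod X]eq_fun do rewrite iprod1.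
      rewrite iprod1; over.
    by rewrite integral_cst// mul1e; exact: probability_setT.
  set rho := (posL i w).1; set t := half_chord r rho.
  (* The split is needed because a line that misses the disk has [t = 0], for which [-t, t] is the
     point 0 and not empty. All factors of such a line are 1, in accordance with [f = 1] there. *)
  have [rr|rr] := leP (rho ^+ 2) (r ^+ 2); last first.
    under eq_integral.
      move=> w' _.
      rewrite (_ : iprod _ = 1); last first.
        rewrite -[RHS]iprod1; congr iprod; apply/funext => j.
        rewrite -[RHS]iprod1; congr iprod; apply/funext => k.
        rewrite [X in _ && X]lt_geF ?andbF//.
        by rewrite (lt_le_trans rr)// lerDl sqr_ge0.
      over.
    rewrite integral_cst// mul1e /f /half_chord ler0_sqrtr ?subr_le0 ?ltW//.
    by rewrite g_fn0// expR0; exact: probability_setT.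
  have t0 : 0 <= t by exact: sqrtr_ge0.
  rewrite -(@mcp_pgf _ _ _ P m lamP a s m0 lamP0 a0 s01 I G mG indG (iP i) (iD i)
    _ _ (presP i) (posP i) (presD i) (posD i))//.
  - apply: eq_integral => w' _; congr (iprod _)%:E; apply/funext => j.
    congr iprod; apply/funext => k; congr (if _ && _ then _ else _).
    rewrite asboolb /= in_itv/= -ler_norml -[RHS]ler_sqr ?nnegrE//.
    rewrite real_normK ?num_real// /t /half_chord sqr_sqrtr ?subr_ge0//.
    by rewrite lerBrDl.
  - by move=> j j' [].
transitivity (\int[P]_w (ppprod (X := measurableTypeR R) presL
  (fun i w0 => (posL i w0).1) f w)%:E)%E.
  apply: eq_integral => w _.
  (* The block of line [i]: its parents together with the daughters of all of them. *)
  pose K i : set I := [set iP i] `|` [set iD i j | j in setT].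
  apply: (@integral_iprod_blocks _ _ _ P I G mG indG K (fun i w' => H i (w, w'))) => //.
  - move=> i i' ii'; apply/seteqP; split => // k [[->|[j _ <-]] [|[j' _]]] //=.
    + by case=> e; rewrite e eqxx in ii'.
    + by case=> e; rewrite e eqxx in ii'.
  - move=> i.
    have subP' : pp_events (presP i) (posP i) `<=` \bigcup_(k in K i) G k.
      by move=> B h; exists (iP i) => //; left.
    have subD' j : pp_events (presD i j) (posD i j) `<=` \bigcup_(k in K i) G k.
      by move=> B h; exists (iD i j) => //; right; exists j.
    apply: measurable_iprod => [j|j z]; last by apply: iprod_01 => k; exact: if_01.
    apply: measurable_iprod => [k|k z]; last exact: if_01.
    apply: (mb _ _ (cst (presL i w)) _ _ (cst (posL i w).1)) => //.
    + exact: (measurable_pres j subP').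
    + exact: (measurable_pres k (@subD' j)).
    + exact: (measurable_pos j subP').
    + exact: (measurable_pos k (@subD' j)).
have lamLpi : 0 <= lamL * pi by rewrite mulr_ge0 ?pi_ge0// ltW.
pose mu : {measure set (measurableTypeR R) -> \bar R} :=
  mscale (NngNum lamLpi) lebesgue_measure.
have muE := PPP_rho lamLpi pppL.
have [mpres [mpos _]] := muE.
have cf : continuous f.
  move=> x; apply: continuous_cvg; first exact: continuous_expR.
  apply: (@continuous_comp _ _ _ (half_chord r) (g_fn m lamP a s)).
    exact: continuous_half_chord.
  exact: continuous_g_fn.
have mf : measurable_fun setT f by exact: continuous_measurable_fun.
(* Beyond distance [r] the half-chord and hence [g] vanish, so [f] is 1 off [-r, r]. *)
rewrite (@integral_ppprod _ _ _ _ (measurableTypeR R) _ _ _ mpres mpos mu muE f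
  `[- r, r]%classic) //.
- rewrite /mu ge0_integral_mscale//.
  + rewrite /f /= integral_lines//=; congr (expR _)%:E; ring.
  + by apply/measurable_EFinP; exact: measurable_funB.
  + by move=> y _; rewrite lee_fin subr_ge0; have /andP[] := f01 y.
- rewrite /mu/= /mscale/= lebesgue_measure_itv/= lte_fin; case: ifP => _.
    by rewrite -EFinB -EFinM ltry.
  by rewrite mule0 ltry.
- move=> x; rewrite /= in_itv/= => /negP; rewrite -ler_norml -ltNge => rx.
  rewrite /f /half_chord ler0_sqrtr ?g_fn0 ?expR0//.
  by rewrite subr_le0 -(real_normK (num_real x)) ler_sqr ?nnegrE// ltW// (lt_trans r0).
Qed.
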